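(* Let $\mathbb{G}$ be a Carnot group with Carnot--Carath\'eodory distance $d$ and basis $X_1,\dots,X_m$ of the first layer $V_1$ of its Lie algebra. Suppose $f\colon\mathbb{G}\to\mathbb{R}$ is Lipschitz with respect to $d$ and $x\in\mathbb{G}$ has the following properties: \begin{itemize} \item $X_1f(x),\dots,X_mf(x)$ exist; \item directional derivatives of $f$ act linearly at $x$; \item $x$ is a regular point of $f$. \end{itemize} Then $f$ is Pansu differentiable at $x$ with group linear derivative $L(\cdot)=\langle p(\cdot),\nabla_Hf(x)\rangle$, where $p\colon\mathbb{G}\to\mathbb{R}^m$ is the projection onto the first $m$ coordinates, $\nabla_H f(x)=(X_1f(x),\dots,X_mf(x))\in\mathbb{R}^m$, and $\langle\cdot,\cdot\rangle$ is the Euclidean inner product on $\mathbb{R}^m$.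
   Context: Carnot group: a connected, simply connected finite dimensional Lie group $\mathbb{G}$ whose Lie algebra $\mathfrak{g}$ (left invariant vector fields) is stratified of step $s$: $\mathfrak{g}=V_1\oplus\cdots\oplus V_s$ with $[V_1,V_i]=V_{i+1}$ for $1\le i\le s-1$ and $[V_1,V_s]=\{0\}$, where $[V_1,V_i]=\mathrm{span}\{[a,b]:a\in V_1,b\in V_i\}$. Fix a basis $X_1,\dots,X_n$ of $\mathfrak{g}$ adapted to the stratification (a union of consecutive bases of $V_1,\dots,V_s$), so $X_1,\dots,X_m$ is a basis of $V_1$, where $m=\dim V_1$. The map $\exp\colon\mathfrak{g}\to\mathbb{G}$ is the exponential map (a diffeomorphism); $\mathbb{G}$ is identified with $\mathbb{R}^n$ via $\exp(x_1X_1+\cdots+x_nX_n)\leftrightarrow(x_1,\dots,x_n)$, so the identity is $0$ and $p(x)=(x_1,\dots,x_m)$. Dilations: $\delta_t(x_1,\dots,x_n)=(t^{d_1}x_1,\dots,t^{d_n}x_n)$, where $d_j=i$ if $X_j\in V_i$; the formula is used for all real $t$. Carnot--Carath\'eodory distance: an absolutely continuous curve $\gamma\colon[a,b]\to\mathbb{G}$ is horizontal if there are $u_1,\dots,u_m\in L^1[a,b]$ with $\gamma'(t)=\sum_{j=1}^m u_j(t)X_j(\gamma(t))$ for almost every $t$; its length is $L(\gamma)=\int_a^b|u(t)|\,dt$ with $|\cdot|$ the Euclidean norm on $\mathbb{R}^m$. Then $d(x,y)$ is the infimum of $L(\gamma)$ over horizontal curves $\gamma\colon[0,1]\to\mathbb{G}$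 joining $x$ to $y$; write $d(x)=d(x,0)$. Directional derivative: for $f\colon\mathbb{G}\to\mathbb{R}$, $x\in\mathbb{G}$, $E\in V_1$, $Ef(x)=\lim_{t\to0}\frac{f(x\exp(tE))-f(x)}{t}$, when this limit exists. Directional derivatives of $f$ act linearly at $x$ if whenever $E_1f(x)$ and $E_2f(x)$ exist for some $E_1,E_2\in V_1$, then for all $a_1,a_2\in\mathbb{R}$ the directional derivative $(a_1E_1+a_2E_2)f(x)$ exists and equals $a_1E_1f(x)+a_2E_2f(x)$. Regular point: $x\in\mathbb{G}$ is a regular point of $f$ if for every $E\in V_1$ for which $Ef(x)$ exists, \[\lim_{t\to0}\frac{f(x\delta_t(u)\exp(tE))-f(x\delta_t(u))}{t}=Ef(x)\] uniformly for $u\in\mathbb{G}$ with $d(u)\le1$. Pansu differentiability (real-valued case): a map $L\colon\mathbb{G}\to\mathbb{R}$ is group linear if $L(xy)=L(x)+L(y)$ and $L(\delta_r(x))=rL(x)$ for all $x,y\in\mathbb{G}$, $r>0$. A function $f\colon\mathbb{G}\to\mathbb{R}$ is Pansu differentiable at $x$ with derivative $L$ if $L$ is group linear and $\lim_{h\to0}\frac{|f(xh)-f(x)-L(h)|}{d(h)}=0$. *)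

(* Defs.v *)
From HB Require Import structures.
From mathcomp Require Import all_boot all_order all_algebra.
From mathcomp Require Import all_classical all_reals all_analysis.

Set Implicit Arguments.
Unset Strict Implicit.
Unset Printing Implicit Defensive.

Import Order.TTheory GRing.Theory Num.Theory.
Import numFieldNormedType.Exports.

Local Open Scope classical_set_scope.
Local Open Scope ring_scope.

(* C^k and C^oo maps between finite dimensional spaces: f is C^(k+1) iff it is
   Frechet differentiable and all its directional derivatives are C^k. *)
Fixpoint Ck (R : realType) (V W : normedModType R) (k : nat) (f : V -> W) :
    Prop :=
  match k with
  | 0 => continuous f
  | k'.+1 => (forall x, differentiable f x) /\
             (forall v, Ck k' (fun x => 'D_v f x))
  end.

Definition smooth (R : realType) (V W : normedModType R) (f : V -> W) : Prop :=
  forall k, Ck k f.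

(* Lie groups whose underlying manifold is a vector space V (below, V = R^n),
   with identity element 0. *)
Record lieGroup (R : realType) (V : normedModType R) := LieGroup {
  lg_mul : V -> V -> V;
  lg_inv : V -> V;
  lg_mulA : associative lg_mul;
  lg_mul0g : left_id 0 lg_mul;
  lg_mulVg : left_inverse 0 lg_inv lg_mul;
  lg_smooth_mul : smooth (fun xy : V * V => lg_mul xy.1 xy.2);
  lg_smooth_inv : smooth lg_inv
}.

Section lie_algebra.
Context (R : realType) (V : normedModType R).
Implicit Types (X Y : V -> V).

Definition left_invariant (G : lieGroup V) : set (V -> V) :=
  [set X | forall x y, 'D_(X y) (lg_mul G x) y = X (lg_mul G x y)].

(* The commutator XY - YX of X and Y, seen as first order operators. *)
Definition bracket X Y : V -> V :=
  fun x => 'D_(X x) Y x - 'D_(Y x) X x.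

Definition span (A : set (V -> V)) : set (V -> V) :=
  [set X | exists (k : nat) (c : 'I_k -> R) (Z : 'I_k -> V -> V),
    (forall i, A (Z i)) /\ X = fun x => \sum_(i < k) c i *: Z i x].

Definition bracket_span (A B : set (V -> V)) : set (V -> V) :=
  span [set Z | exists X Y, [/\ A X, B Y & Z = bracket X Y]].

(* y = exp(X): y is reached at time 1 by the integral curve of X that starts
   at the identity. *)
Definition is_exp X (y : V) : Prop :=
  exists gamma : R -> V,
    [/\ gamma 0 = 0,
        forall t : R, is_derive t 1 gamma (X (gamma t)) &
        gamma 1 = y].

End lie_algebra.

Section frames.
Context (R : realType) (n : nat).
Local Notation V := 'rV[R]_n.

Definition frame_comb (X : 'I_n -> V -> V) (a : V) : V -> V :=
  fun x => \sum_(j < n) a 0 j *: X j x.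

Definition is_basis (g : set (V -> V)) (X : 'I_n -> V -> V) : Prop :=
  (forall a, g (frame_comb X a)) /\
  (forall Y, g Y -> exists! a : V, Y = frame_comb X a).

Definition layer (X : 'I_n -> V -> V) (deg : 'I_n -> nat) (i : nat) :
    set (V -> V) :=
  span [set Y | exists2 j, deg j = i & Y = X j].

End frames.

(* A Carnot group in exponential coordinates with respect to an adapted basis
   X_1, ..., X_n of its Lie algebra. Here n = m + r with m = dim V_1, so that
   V_1 corresponds to the left block of a row vector; cg_deg j is the index of
   the layer that contains X_j. *)
Record carnotGroup (R : realType) (m r : nat) := CarnotGroup {
  cg_lie :> lieGroup 'rV[R]_(m + r);
  cg_step : nat;
  cg_X : 'I_(m + r) -> 'rV[R]_(m + r) -> 'rV[R]_(m + r);
  cg_deg : 'I_(m + r) -> nat;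
  cg_basis : is_basis (left_invariant cg_lie) cg_X;
  cg_deg_range : forall j, (1 <= cg_deg j <= cg_step)%N;
  cg_deg_mono : forall i j : 'I_(m + r), (i <= j)%N -> (cg_deg i <= cg_deg j)%N;
  cg_deg1 : forall j : 'I_(m + r), (cg_deg j == 1%N) = (j < m)%N;
  cg_stratified : forall i, (1 <= i < cg_step)%N ->
    bracket_span (layer cg_X cg_deg 1) (layer cg_X cg_deg i)
    = layer cg_X cg_deg i.+1;
  cg_last_layer :
    bracket_span (layer cg_X cg_deg 1) (layer cg_X cg_deg cg_step)
    = [set fun=> 0];
  cg_exp : forall x, is_exp (frame_comb cg_X x) x
}.

Definition absolutely_continuous (R : realType) (V : normedModType R)
    (a b : R) (g : R -> V) : Prop :=
  forall eps : R, 0 < eps -> exists2 delta : R, 0 < delta &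
    forall (k : nat) (s t : 'I_k -> R),
      (forall i, [/\ a <= s i, s i <= t i & t i <= b]) ->
      trivIset [set: 'I_k] (fun i => `]s i, t i[%classic) ->
      \sum_(i < k) (t i - s i) < delta ->
      \sum_(i < k) `|g (t i) - g (s i)| < eps.

Definition dotv (R : realType) (m : nat) (u v : 'rV[R]_m) : R :=
  \sum_(j < m) u 0 j * v 0 j.

Definition enorm (R : realType) (m : nat) (u : 'rV[R]_m) : R :=
  Num.sqrt (dotv u u).

Section carnot.
Context (R : realType) (m r : nat) (G : carnotGroup R m r).
Local Notation V := 'rV[R]_(m + r).
Local Notation mu := (@lebesgue_measure R).
Implicit Types (x y h : V) (e : 'rV[R]_m) (t : R).

Local Notation "x '**' y" := (lg_mul G x y) (at level 40, left associativity).

Definition horizontal_curve (a b : R) (gamma : R -> V) (u : R -> 'rV[R]_m) :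
    Prop :=
  [/\ absolutely_continuous a b gamma,
      forall j : 'I_m, mu.-integrable `[a, b] (EFin \o (fun t => u t 0 j)) &
      {ae mu, forall t, t \in `[a, b] ->
        is_derive t 1 gamma
          (\sum_(j < m) u t 0 j *: cg_X G (lshift r j) (gamma t))}].

Definition curve_length (a b : R) (u : R -> 'rV[R]_m) : R :=
  \int[mu]_(t in `[a, b]) enorm (u t).

(* The set of lengths is nonempty by Chow's theorem, so the convention for the
   infimum of the empty set plays no role. *)
Definition cc_dist x y : R :=
  inf [set l | exists gamma u,
    [/\ horizontal_curve 0 1 gamma u, gamma 0 = x, gamma 1 = y &
        l = curve_length 0 1 u]].

Definition cc_norm x : R := cc_dist x 0.

Definition cc_lipschitz (f : V -> R) : Prop :=
  exists K : R, forall x y, `|f x - f y| <= K * cc_dist x y.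

Definition dil t x : V := \row_j (t ^+ cg_deg G j * x 0 j).

Definition horproj x : 'rV[R]_m := lsubmx x.

(* The element E = sum_j e_j X_j of V_1 is represented by its coordinates e;
   in exponential coordinates exp(E) is (e, 0). *)
Definition exp_V1 e : V := row_mx e 0.

Definition diff_quot (f : V -> R) x e t : R :=
  (f (x ** exp_V1 (t *: e)) - f x) / t.

Definition dir_derivable (f : V -> R) x e : Prop :=
  cvg (diff_quot f x e t @[t --> 0^']).

Definition dir_deriv (f : V -> R) x e : R :=
  lim (diff_quot f x e t @[t --> 0^']).

Definition dir_derivs_act_linearly (f : V -> R) x : Prop :=
  forall e1 e2, dir_derivable f x e1 -> dir_derivable f x e2 ->
  forall a1 a2 : R,
    dir_derivable f x (a1 *: e1 + a2 *: e2) /\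
    dir_deriv f x (a1 *: e1 + a2 *: e2) =
      a1 * dir_deriv f x e1 + a2 * dir_deriv f x e2.

Definition regular_point (f : V -> R) x : Prop :=
  forall e, dir_derivable f x e ->
  forall eps : R, 0 < eps ->
  \forall t \near 0^', forall u, cc_norm u <= 1 ->
    `|diff_quot f (x ** dil t u) e t - dir_deriv f x e| < eps.

Definition group_linear (L : V -> R) : Prop :=
  (forall x y, L (x ** y) = L x + L y) /\
  (forall (t : R) x, 0 < t -> L (dil t x) = t * L x).

Definition pansu_differentiable (f : V -> R) x (L : V -> R) : Prop :=
  group_linear L /\
  `|f (x ** h) - f x - L h| / cc_norm h @[h --> (0 : V)^'] --> (0 : R).

Definition hor_gradient (f : V -> R) x : 'rV[R]_m :=
  \row_(j < m) dir_deriv f x (delta_mx 0 j).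

End carnot.

(* Main.v *)
(* In exponential coordinates the left-invariant coframe along a ray s |-> s x
   solves the linear equation J' = v - [x, J], whose coefficients are structure
   constants of the Lie algebra. As the stratification makes dil t respect
   brackets, dil t preserves this equation, hence it is a group automorphism;
   the same equation shows that the first m coordinates are additive.

   A quantitative form of Chow's theorem comes from conjugates: the vectors
   g exp(E) g^-1, with E in V_1 and g a product of exponentials of V_1, span the
   Lie algebra, because their span is stable under ad E for E in V_1. An inverse
   function argument then reaches a neighbourhood of 0 by products of
   exponentials of bounded total length, and dilations make that length small.

   For a fixed product g of exponentials, regularity and linearity give
   f(x dil_t g) = f(x) + t <p(g), grad f(x)> + o(t) factor by factor. The Lipschitz
   bound, Chow's theorem and compactness make this uniform for g in the Euclidean
   unit ball. Since a horizontal curve needs a definite length to leave that ball,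
   every h is dil_t g with g in the ball and t at most a multiple of d(h). *)

Require Import Defs.
From HB Require Import structures.
From mathcomp Require Import all_boot all_order all_algebra.
From mathcomp Require Import all_classical all_reals all_analysis.
From mathcomp Require Import measurable_realfun ring lra.

Set Implicit Arguments.
Unset Strict Implicit.
Unset Printing Implicit Defensive.

Import Order.TTheory GRing.Theory Num.Theory.
Import numFieldNormedType.Exports.
Local Open Scope classical_set_scope.
Local Open Scope ring_scope.

(** * Calculus along curves *)

Section calculus.
Context (R : realType).
Implicit Types U V W : normedModType R.

(** The product is given only as a smooth map, and no polynomial formula for it is assumed; what is
    needed of it comes from differentiating associativity and from uniqueness of integral curves.
    Uniqueness is always reduced to a vanishing derivative: for integral curves, that of a quotient
    of the two; for the coframe equation, that of one coordinate at a time, because [[x, .]]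
    strictly raises the degree. The spanning conjugates can serve as coordinate directions because
    conjugation maps rays to rays: a step along such a direction is a word in horizontal
    exponentials of controlled length. The only curves ever built are single exponentials and
    dilates of given curves. The Lipschitz bound for a product telescopes in the values of [f], so
    curves are never concatenated, and where the set of lengths might be empty its infimum [0] is
    used. A lower bound for [d], on the other hand, concerns all curves that are merely absolutely
    continuous with integrable control; this is what the gauge argument is for. *)

Lemma derive_comp U V W (f : U -> V) (g : V -> W) x v :
  differentiable f x -> differentiable g (f x) ->
  'D_v (fun y => g (f y)) x = 'D_('D_v f x) g (f x).
Proof.
move=> df dg; rewrite (deriveE v df) (deriveE _ dg).
have dc : differentiable (g \o f) x by exact: differentiable_comp.
by rewrite -[LHS]/('D_v (g \o f) x) (deriveE v dc) diff_comp.
Qed.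

Lemma derive_dirD U V (f : U -> V) x u v : differentiable f x ->
  'D_(u + v) f x = 'D_u f x + 'D_v f x.
Proof. by move=> df; rewrite !(deriveE _ df) linearD. Qed.

Lemma derive_dirZ U V (f : U -> V) x (a : R) v : differentiable f x ->
  'D_(a *: v) f x = a *: 'D_v f x.
Proof. by move=> df; rewrite !(deriveE _ df) linearZ. Qed.

Lemma derive_dir_sum U V (f : U -> V) x n (u : 'I_n -> U) : differentiable f x ->
  'D_(\sum_(i < n) u i) f x = \sum_(i < n) 'D_(u i) f x.
Proof.
move=> df; rewrite (deriveE _ df) linear_sum.
by apply: eq_bigr => i _; rewrite (deriveE _ df).
Qed.

Lemma is_deriveE U V (f : U -> V) x v df : is_derive x v f df -> 'D_v f x = df.
Proof. by case. Qed.

Lemma is_derive_curve_differentiable V (g : R -> V) (t : R) v :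
  is_derive t 1 g v -> differentiable g t.
Proof. by move=> dg; apply/derivable1_diffP; exact: ex_derive. Qed.

Lemma differentiable_is_derive V (g : R -> V) (t : R) :
  differentiable g t -> is_derive t 1 g ('D_1 g t).
Proof. by move=> dg; apply/derivableP/derivable1_diffP. Qed.

Lemma is_derive_comp_curve V W (g : R -> V) (F : V -> W) (t : R) v :
  is_derive t 1 g v -> differentiable F (g t) ->
  is_derive t 1 (fun s => F (g s)) ('D_v F (g t)).
Proof.
move=> dg dF; have dg' := is_derive_curve_differentiable dg.
have -> : 'D_v F (g t) = 'D_1 (fun s => F (g s)) t.
  by rewrite (derive_comp (1 : R) dg' dF) (is_deriveE dg).
apply: differentiable_is_derive. exact: (@differentiable_comp _ _ _ _ g F).
Qed.

Lemma is_derive_pair V W (g : R -> V) (h : R -> W) (t : R) v w :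
  is_derive t 1 g v -> is_derive t 1 h w ->
  is_derive t 1 (fun s => (g s, h s)) (v, w).
Proof.
move=> dg dh.
have dg' := is_derive_curve_differentiable dg.
have dh' := is_derive_curve_differentiable dh.
have d := differentiable_pair dg' dh'.
have -> : (v, w) = 'D_1 (fun s => (g s, h s)) t.
  rewrite (deriveE _ d) diff_pair // -(deriveE _ dg') -(deriveE _ dh').
  by rewrite (is_deriveE dg) (is_deriveE dh).
exact: differentiable_is_derive.
Qed.

Lemma is_derive_line V (a v : V) (t : R) : is_derive t 1 (fun s : R => a + s *: v) v.
Proof.
have h := is_diff_scalel 1 v.
have dl : differentiable (fun s : R => s *: v) t by [].
apply: DeriveDef; first by apply/derivable1_diffP; exact: differentiableD.
rewrite -[fun _ => _]/(cst a + (fun s : R => s *: v)) deriveD //; last first.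
  exact/derivable1_diffP.
by rewrite derive_cst add0r (deriveE _ dl) diff_val scale1r.
Qed.

Lemma is_derive_ray V (v : V) (t : R) : is_derive t 1 (fun s : R => s *: v) v.
Proof.
have := is_derive_line 0 v t.
by under eq_fun do rewrite add0r.
Qed.

Lemma is_derive_reparam V (g : R -> V) (s t : R) v :
  is_derive (s * t) 1 g v -> is_derive t 1 (fun a => g (s * a)) (s *: v).
Proof.
move=> dg; have dm : is_derive t 1 (fun a : R => s * a) s.
  have := is_derive_ray (s : R^o) t; by under eq_fun do rewrite -[_ *: _]/(_ * _) mulrC.
have dg' := is_derive_curve_differentiable dg.
have e : 'D_(s : R) g (s * t) = s *: v.
  have := derive_dirZ s (1 : R) dg'.
  by rewrite (is_deriveE dg) -[s *: 1]/(s * 1) mulr1.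
rewrite -e; exact: is_derive_comp_curve.
Qed.

Lemma derive_along_line V W (F : V -> W) x v : differentiable F x ->
  is_derive (0 : R) 1 (fun s => F (x + s *: v)) ('D_v F x).
Proof.
move=> dF; have := @is_derive_comp_curve _ _ (fun s => x + s *: v) F 0 v (is_derive_line _ _ _).
by rewrite scale0r addr0; apply.
Qed.

Lemma is_derive_unique U V (f : U -> V) x u v w :
  is_derive x u f v -> is_derive x u f w -> v = w.
Proof. by move=> [_ <-] [_ <-]. Qed.

Lemma curve_derive0_cst n (g : R -> 'rV[R]_n) :
  (forall t : R, is_derive t 1 g 0) -> forall t, g t = g 0.
Proof.
move=> dg t; apply/rowP => i.
apply: (@is_derive_0_is_cst R (fun s => g s 0 i)) => s.
have := dg s => /[dup] -[d v] _.
have d' := (derivable_mxP _ _ _).1 d 0 i.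
apply: DeriveDef => //.
by move/(congr1 (fun M : 'rV_n => M 0 i)): v; rewrite derive_mx // !mxE.
Qed.

End calculus.

(** * Left-invariant fields of a Lie group on R^n *)

Section lie_group.
Context (R : realType) (n : nat) (G : lieGroup 'rV[R]_n).
Local Notation V := 'rV[R]_n.
Local Notation "x '**' y" := (lg_mul G x y) (at level 40, left associativity).
Local Notation inv := (lg_inv G).
Implicit Types (x y z a b c u v w : V) (t s : R).

(** [dmul1 a b] is the differential at [a] of right translation by [b], and [dmul2 a b] the
    differential at [b] of left translation by [a]. *)
Definition dmul1 a b u := 'D_(u, 0) (fun p : V * V => p.1 ** p.2) (a, b).
Definition dmul2 a b v := 'D_(0, v) (fun p : V * V => p.1 ** p.2) (a, b).

Lemma lg_mulgV x : x ** inv x = 0.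
Proof.
rewrite -[LHS](lg_mul0g G) -{1}(lg_mulVg G (inv x)) -lg_mulA.
by rewrite (lg_mulA G (inv x)) lg_mulVg lg_mul0g lg_mulVg.
Qed.

Lemma lg_mulg0 x : x ** 0 = x.
Proof. by rewrite -(lg_mulVg G x) lg_mulA lg_mulgV lg_mul0g. Qed.

Lemma lg_mulKg x y : inv x ** (x ** y) = y.
Proof. by rewrite lg_mulA lg_mulVg lg_mul0g. Qed.

Lemma lg_mulVKg x y : x ** (inv x ** y) = y.
Proof. by rewrite lg_mulA lg_mulgV lg_mul0g. Qed.

Lemma lg_mulgI x : injective (lg_mul G x).
Proof. by move=> y z /(congr1 (lg_mul G (inv x))); rewrite !lg_mulKg. Qed.

Lemma lg_mulIg x y z : y ** x = z ** x -> y = z.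
Proof.
move=> /(congr1 (fun w => w ** inv x)).
by rewrite -!lg_mulA lg_mulgV !lg_mulg0.
Qed.

Lemma lg_invP x y : x ** y = 0 -> y = inv x.
Proof. by move=> xy; apply: (@lg_mulgI x); rewrite xy lg_mulgV. Qed.

Lemma lg_inv0 : inv 0 = 0.
Proof. by apply/esym/lg_invP; rewrite lg_mul0g. Qed.

Lemma lg_invM x y : inv (x ** y) = inv y ** inv x.
Proof. by apply/esym/lg_invP; rewrite -lg_mulA lg_mulVKg lg_mulgV. Qed.

Lemma differentiable_mul p : differentiable (fun p : V * V => p.1 ** p.2) p.
Proof. exact: (lg_smooth_mul G 1).1. Qed.
Hint Resolve differentiable_mul : core.

Lemma differentiable_inv x : differentiable inv x.
Proof. exact: (lg_smooth_inv G 1).1. Qed.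

Lemma is_derive_mul (g h : R -> V) t v w :
  is_derive t 1 g v -> is_derive t 1 h w ->
  is_derive t 1 (fun s => g s ** h s) (dmul1 (g t) (h t) v + dmul2 (g t) (h t) w).
Proof.
move=> dg dh.
have := is_derive_comp_curve (is_derive_pair dg dh) (differentiable_mul (g t, h t)).
have := derive_dirD (v, 0 : V) (0, w) (differentiable_mul (g t, h t)).
by rewrite -[(v, 0) + _]/(v + 0, 0 + w) addr0 add0r => ->.
Qed.

Lemma dmul1_0 a b : dmul1 a b 0 = 0. Proof. exact: derive0. Qed.
Lemma dmul2_0 a b : dmul2 a b 0 = 0. Proof. exact: derive0. Qed.

Lemma dmul2D a b u v : dmul2 a b (u + v) = dmul2 a b u + dmul2 a b v.
Proof.
have := derive_dirD (0 : V, u) (0, v) (differentiable_mul (a, b)).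
by rewrite -[(0, u) + _]/(0 + 0, u + v) addr0.
Qed.

Lemma dmul2Z a b s v : dmul2 a b (s *: v) = s *: dmul2 a b v.
Proof.
have := derive_dirZ s (0 : V, v) (differentiable_mul (a, b)).
by rewrite -[s *: (0, v)]/(s *: 0, s *: v) scaler0.
Qed.

Lemma dmul1D a b u v : dmul1 a b (u + v) = dmul1 a b u + dmul1 a b v.
Proof.
have := derive_dirD (u, 0 : V) (v, 0) (differentiable_mul (a, b)).
by rewrite -[(u, 0) + _]/(u + v, 0 + 0) addr0.
Qed.

Lemma dmul1Z a b s v : dmul1 a b (s *: v) = s *: dmul1 a b v.
Proof.
have := derive_dirZ s (v, 0 : V) (differentiable_mul (a, b)).
by rewrite -[s *: (v, 0)]/(s *: v, s *: 0) scaler0.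
Qed.

Lemma is_derive_mulr (h : R -> V) a t w : is_derive t 1 h w ->
  is_derive t 1 (fun s => a ** h s) (dmul2 a (h t) w).
Proof.
move=> dh; have := is_derive_mul (is_derive_cst a _ _) dh.
by rewrite dmul1_0 add0r.
Qed.

Lemma is_derive_mull (g : R -> V) a t w : is_derive t 1 g w ->
  is_derive t 1 (fun s => g s ** a) (dmul1 (g t) a w).
Proof.
move=> dg; have := is_derive_mul dg (is_derive_cst a _ _).
by rewrite dmul2_0 addr0.
Qed.

(** Associativity differentiated in its last argument; [dmul12_assoc] differentiates it in the
    middle one and expresses that left and right translations commute. *)
Lemma dmul2_assoc a b c v : dmul2 (a ** b) c v = dmul2 a (b ** c) (dmul2 b c v).
Proof.
have d1 := is_derive_mulr (a ** b) (is_derive_line c v 0).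
have d2 := is_derive_mulr a (is_derive_mulr b (is_derive_line c v 0)).
move: d1 d2; rewrite /= scale0r addr0 => d1 d2.
by apply: is_derive_unique d1 _; under eq_fun do rewrite -lg_mulA.
Qed.

Lemma dmul12_assoc a b c v :
  dmul1 (a ** b) c (dmul2 a b v) = dmul2 a (b ** c) (dmul1 b c v).
Proof.
have d1 := is_derive_mull c (is_derive_mulr a (is_derive_line b v 0)).
have d2 := is_derive_mulr a (is_derive_mull c (is_derive_line b v 0)).
move: d1 d2; rewrite /= scale0r addr0 => d1 d2.
by apply: is_derive_unique d1 _; under eq_fun do rewrite -lg_mulA.
Qed.

Lemma dmul12_0 a c v : dmul1 a c (dmul2 a 0 v) = dmul2 a c (dmul1 0 c v).
Proof. by have := dmul12_assoc a 0 c v; rewrite lg_mulg0 lg_mul0g. Qed.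

Lemma dmul2_1 b v : dmul2 0 b v = v.
Proof.
have := is_derive_mulr 0 (is_derive_line b v 0); rewrite scale0r addr0.
under eq_fun do rewrite lg_mul0g.
by move=> d; apply: is_derive_unique d (is_derive_line _ _ _).
Qed.

Lemma dmul1_1 a v : dmul1 a 0 v = v.
Proof.
have := is_derive_mull 0 (is_derive_line a v 0); rewrite scale0r addr0.
under eq_fun do rewrite lg_mulg0.
by move=> d; apply: is_derive_unique d (is_derive_line _ _ _).
Qed.

Lemma dmul2K a b v : dmul2 (inv a) (a ** b) (dmul2 a b v) = v.
Proof. by rewrite -dmul2_assoc lg_mulVg dmul2_1. Qed.

Lemma dmul2_inj a b u v : dmul2 a b u = dmul2 a b v -> u = v.
Proof. by move=> e; rewrite -(dmul2K a b u) e dmul2K. Qed.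

Lemma derive_mulr a b v : 'D_v (lg_mul G a) b = dmul2 a b v.
Proof.
have d := is_derive_mulr a (is_derive_line b v 0).
have db : differentiable (lg_mul G a) b.
  have := @differentiable_comp _ _ _ _ (fun y : V => (a, y)) _ b _ (differentiable_mul (a, b)).
  by apply; apply: differentiable_pair.
have := derive_along_line v db; move: d; rewrite scale0r addr0 => d1 d2.
exact: is_derive_unique d2 d1.
Qed.

Lemma left_invariantE X : left_invariant G X -> forall x, X x = dmul2 x 0 (X 0).
Proof. by move=> lX x; rewrite -derive_mulr lX lg_mulg0. Qed.

Lemma left_invariant_mul X x y : left_invariant G X ->
  X (x ** y) = dmul2 x y (X y).
Proof. by move=> lX; rewrite -derive_mulr lX. Qed.

(* [g1 * g2^-1] has derivative 0. *)
Lemma integral_curve_unique X (g1 g2 : R -> V) : left_invariant G X ->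
  (forall t : R, is_derive t 1 g1 (X (g1 t))) ->
  (forall t : R, is_derive t 1 g2 (X (g2 t))) ->
  g1 0 = g2 0 -> forall t, g1 t = g2 t.
Proof.
move=> lX d1 d2 g0 t.
pose w := X 0.
(* In matrix notation [g2' = g2 w], and differentiating [g2 g2^-1 = 0] gives
   [(g2^-1)' = - w g2^-1]. *)
have dinv s : is_derive s 1 (fun s => inv (g2 s)) (- dmul1 0 (inv (g2 s)) w).
  have di := is_derive_comp_curve (d2 s) (differentiable_inv (g2 s)).
  have := is_derive_mul (d2 s) di.
  under eq_fun do rewrite lg_mulgV.
  move=> /(is_derive_unique (is_derive_cst 0 s (1 : R))).
  rewrite (left_invariantE lX) dmul12_0.
  rewrite -dmul2D => e0.
  have /addr0_eq e := dmul2_inj (etrans (esym e0) (esym (dmul2_0 _ _))).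
  by move: di; rewrite (left_invariantE lX (g2 s)) -e.
have : g1 t ** inv (g2 t) = g1 0 ** inv (g2 0).
  apply: (curve_derive0_cst (g := fun t => g1 t ** inv (g2 t))) => s.
  have := is_derive_mul (d1 s) (dinv s).
  rewrite (left_invariantE lX) dmul12_0.
  by rewrite -dmul2D subrr dmul2_0.
rewrite g0 lg_mulgV -(lg_mulgV (g2 t)); exact: lg_mulIg.
Qed.

End lie_group.

(** * Exponential coordinates: rays, one-parameter subgroups and conjugation *)

Section exponential_coordinates.
Context (R : realType) (m r : nat) (G : carnotGroup R m r).
Local Notation V := 'rV[R]_(m + r).
Local Notation "x '**' y" := (lg_mul G x y) (at level 40, left associativity).
Local Notation inv := (lg_inv G).
Local Notation fc := (frame_comb (cg_X G)).
Implicit Types (x y z a b c u v w : V) (t s : R).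

Lemma frame_left_invariant a : left_invariant G (fc a).
Proof. exact: (cg_basis G).1. Qed.
Hint Resolve frame_left_invariant : core.

Lemma frame_combD a b y : fc (a + b) y = fc a y + fc b y.
Proof.
by rewrite /frame_comb -big_split; apply: eq_bigr => i _; rewrite mxE scalerDl.
Qed.

Lemma frame_combZ s a y : fc (s *: a) y = s *: fc a y.
Proof.
by rewrite /frame_comb scaler_sumr; apply: eq_bigr => i _; rewrite mxE scalerA.
Qed.

(** [cg_exp] only locates the endpoint at time 1. Applied to each [t *: x] and compared, by
    uniqueness, with the curve of [x] run at speed [t], it shows that the curve of [x] is the ray
    itself, whose velocity is [x]. *)
Lemma exp_ray x (s : R) : fc x (s *: x) = x.
Proof.
have [g [g0 dg g1]] := cg_exp G x.
have gE t : g t = t *: x.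
  have [h [h0 dh h1]] := cg_exp G (t *: x).
  rewrite -h1 -[in LHS](mulr1 t).
  apply: (integral_curve_unique (frame_left_invariant (t *: x)) (g1 := fun s => g (t * s))) => //.
    by move=> a; rewrite frame_combZ; exact: is_derive_reparam.
  by rewrite mulr0 g0 h0.
have -> : s *: x = g s by rewrite gE.
apply: is_derive_unique (dg s) _.
by rewrite (_ : g = fun t => t *: x); [exact: is_derive_ray|exact/funext].
Qed.

Lemma frame_comb0 x : fc x 0 = x.
Proof. by rewrite -[RHS](exp_ray x 0) scale0r. Qed.

Lemma frame_comb_dmul2 x w : fc w x = dmul2 G x 0 w.
Proof. by rewrite (left_invariantE (frame_left_invariant w)) frame_comb0. Qed.

Lemma frame_comb_mul x y w : fc w (x ** y) = dmul2 G x y (fc w y).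
Proof. exact: left_invariant_mul. Qed.

Lemma frame_comb_inj u v y : fc u y = fc v y -> u = v.
Proof. by rewrite !frame_comb_dmul2; exact: dmul2_inj. Qed.

Lemma frame_curve_unique a (g1 g2 : R -> V) :
  (forall t : R, is_derive t 1 g1 (fc a (g1 t))) ->
  (forall t : R, is_derive t 1 g2 (fc a (g2 t))) ->
  g1 0 = g2 0 -> forall t, g1 t = g2 t.
Proof. exact: integral_curve_unique. Qed.

Lemma is_derive_exp_curve x w t :
  is_derive t 1 (fun s => x ** (s *: w)) (fc w (x ** (t *: w))).
Proof.
rewrite frame_comb_mul exp_ray.
by have := is_derive_mulr G x (is_derive_ray w t).
Qed.

Lemma mul_ray x s t : (s *: x) ** (t *: x) = (s + t) *: x.
Proof.
apply: (frame_curve_unique (a := x) (g1 := fun t => (s *: x) ** (t *: x))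
    (g2 := fun t => (s + t) *: x)) => [{}t|{}t|].
- exact: is_derive_exp_curve.
- rewrite exp_ray; under eq_fun do rewrite scalerDl; exact: is_derive_line.
- by rewrite scale0r lg_mulg0 addr0.
Qed.

Lemma inv_exp x : inv x = - x.
Proof.
apply/esym/lg_invP; have := mul_ray x 1 (-1).
by rewrite subrr scale0r scale1r scaleN1r.
Qed.

(** The homomorphism law carries the derivative at [0] to every time by a left translation, so [g]
    is an integral curve of the left invariant field with value [w] at the identity, and so is the
    ray. *)
Lemma one_param (g : R -> V) w : (forall s t, g (s + t) = g s ** g t) ->
  is_derive (0 : R) 1 g w -> forall s, g s = s *: w.
Proof.
move=> gD dg.
have g0 : g 0 = 0.
  by apply: (@lg_mulgI _ _ G (g 0)); rewrite -gD lg_mulg0 addr0.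
apply: (frame_curve_unique (a := w)) => [s|s|].
- rewrite frame_comb_dmul2 -[in dmul2 _ _ 0]g0.
  have d := is_derive_mulr G (g s) dg.
  have d1 : is_derive (0 : R) 1 (fun t => g (s + t)) (dmul2 G (g s) (g 0) w).
    by under eq_fun do rewrite gD.
  have dF := is_derive_curve_differentiable d1.
  have ds : is_derive s 1 (fun t => t - s) 1.
    by apply: is_derive_eq; rewrite subr0.
  have := @is_derive_comp_curve _ _ _ _ (fun t => g (s + t)) s 1 ds.
  rewrite subrr (is_deriveE d1) => /(_ dF).
  by under eq_fun do rewrite addrC subrK.
- by rewrite exp_ray; exact: is_derive_ray.
- by rewrite g0 scale0r.
Qed.

(** A conjugate of a one-parameter subgroup is again one, hence a ray. *)
Lemma conj_exp x w t : x ** (t *: w) ** inv x = t *: (x ** w ** inv x).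
Proof.
pose g s := x ** (s *: w) ** inv x.
have gD s s' : g (s + s') = g s ** g s'.
  by rewrite /g -mul_ray -!lg_mulA (lg_mulKg G).
have dg := is_derive_mull G (inv x) (is_derive_exp_curve x w 0).
have gE := one_param gD dg.
rewrite -[LHS]/(g t) -[w in RHS]scale1r -[X in _ = _ *: X]/(g 1).
by rewrite !gE scale1r.
Qed.

End exponential_coordinates.

(** * Symmetry of second derivatives and the Jacobi identity *)

Section second_derivatives.
Context (R : realType).

Lemma MVT_curve (g dg : R -> R) (h : R) : 0 < h ->
  (forall t : R, is_derive t 1 g (dg t)) ->
  exists2 c, 0 < c < h & g h - g 0 = dg c * h.
Proof.
move=> h0 dgt; have cg : {within `[0, h], continuous g}.
  apply: continuous_subspaceT => t.
  by apply: differentiable_continuous; apply: is_derive_curve_differentiable (dgt t).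
have [c] := MVT h0 (fun t _ => dgt t) cg.
by rewrite in_itv /= subr0 => ? ?; exists c.
Qed.

Lemma dist_half2 (e p q c : R) :
  `|p - c| < e / 2 -> `|q - c| < e / 2 -> `|p - q| <= e.
Proof. by rewrite !ltr_norml ler_norml => /andP[? ?] /andP[? ?]; lra. Qed.

Context (U : normedModType R).

Lemma is_derive_mx (V : normedModType R) n (F : V -> 'rV[R]_n) x v (d : 'rV[R]_n) :
  (forall i, is_derive x v (fun y : V => F y 0 i) (d 0 i)) ->
  is_derive x v F d.
Proof.
move=> dF; have dd : derivable F x v.
  apply/derivable_mxP => i j; rewrite ord1.
  by have [] := dF j.
apply: DeriveDef => //; apply/rowP => i; rewrite derive_mx // mxE.
exact: is_deriveE.
Qed.

Lemma is_derive_coord (V : normedModType R) n (F : V -> 'rV[R]_n) x v (d : 'rV[R]_n) i :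
  is_derive x v F d -> is_derive x v (fun y => F y 0 i) (d 0 i).
Proof.
move=> [dF e]; apply: DeriveDef; first exact: (derivable_mxP _ _ _).1.
by rewrite -e derive_mx // mxE.
Qed.

Lemma derive_coord n (F : U -> 'rV[R]_n) x v i : differentiable F x ->
  'D_v (fun y => F y 0 i) x = 'D_v F x 0 i.
Proof.
move=> dF; apply/is_deriveE/is_derive_coord/derivableP.
exact: diff_derivable.
Qed.

Lemma Ck_coord n k (F : U -> 'rV[R]_n) i : Ck k F -> Ck k (fun y => F y 0 i).
Proof.
elim: k F => [|k IH] F /=.
  by move=> cF x; apply: (@continuous_comp _ _ _ F (fun M : 'rV_n => M 0 i));
    [exact: cF|exact: coord_continuous].
move=> [dF cF]; split=> [x|v].
  apply: (@differentiable_comp _ _ _ _ F (fun M : 'rV_n => M 0 i)) => //.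
  exact: differentiable_coord.
under eq_fun do rewrite derive_coord //; exact: IH.
Qed.

Section schwarz_scalar.
Variable F : U -> R.
Hypothesis C2F : Ck 2 F.
Let dF x : differentiable F x := C2F.1 x.
Let ddF v x : differentiable (fun y => 'D_v F y) x := (C2F.2 v).1 x.

Let second_difference x u v (h : R) : 0 < h -> exists c : R * R,
  [/\ 0 < c.1 < h, 0 < c.2 < h &
  F (x + h *: u + h *: v) - F (x + h *: u) - F (x + h *: v) + F x =
  'D_v (fun y => 'D_u F y) (x + c.1 *: u + c.2 *: v) * h * h].
Proof.
move=> h0.
have [a aP ea] := @MVT_curve
    (fun s => F ((x + h *: v) + s *: u) - F (x + s *: u))
    (fun s => 'D_u F ((x + h *: v) + s *: u) - 'D_u F (x + s *: u)) h h0
    (fun s => is_deriveB (is_derive_comp_curve (is_derive_line (x + h *: v) u s) (dF _))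
      (is_derive_comp_curve (is_derive_line x u s) (dF _))).
have [b bP eb] := @MVT_curve (fun s => 'D_u F ((x + a *: u) + s *: v))
    (fun s => 'D_v (fun y => 'D_u F y) ((x + a *: u) + s *: v)) h h0
    (fun s => is_derive_comp_curve (is_derive_line (x + a *: u) v s) (ddF u _)).
exists (a, b); split => //=.
rewrite -eb /= !scale0r !addr0 in ea *.
rewrite [x + a *: u + h *: v]addrAC -ea [x + h *: u + h *: v]addrAC.
by rewrite opprD opprK addrA addrAC.
Qed.

(** The second difference over the parallelogram with sides [h *: u] and [h *: v] is symmetric in
    [u] and [v]. Two mean value steps, in either order, turn it into a mixed derivative at a nearby
    point; continuity of both mixed derivatives concludes. *)
Lemma schwarz_scalar x u v :
  'D_v (fun y => 'D_u F y) x = 'D_u (fun y => 'D_v F y) x.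
Proof.
apply/eqP; rewrite -subr_eq0 -normr_le0; apply/ler_addgt0Pr => eps eps0.
rewrite add0r.
pose e2 := eps / 2; have e20 : 0 < e2 by rewrite divr_gt0.
have cont w z : \forall y \near x,
    `|'D_w (fun y => 'D_z F y) x - 'D_w (fun y => 'D_z F y) y| < e2.
  by have /cvgrPdist_lt/(_ _ e20) := (C2F.2 z).2 w x.
have [d /= d0 dP] := (nbhs_ballP _ _).1 (filterI (cont v u) (cont u v)).
(* This size keeps every intermediate point [x + a *: u + b *: v] within [d] of [x]; the summand [1]
   excludes a zero denominator. *)
pose h := d / (2 * (1 + `|u| + `|v|)).
have N0 : 0 < 1 + `|u| + `|v| by rewrite -addrA ltr_pwDl // addr_ge0.
have h0 : 0 < h by rewrite divr_gt0 // mulr_gt0.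
have near a b : 0 < a < h -> 0 < b < h -> ball x d (x + a *: u + b *: v).
  move=> /andP[a0 ah] /andP[b0 bh]; rewrite -ball_normE /ball_ /=.
  rewrite -addrA opprD addNKr normrN.
  apply: (le_lt_trans (ler_normD _ _)); rewrite !normrZ (gtr0_norm a0) (gtr0_norm b0).
  apply: (@le_lt_trans _ _ (h * (1 + `|u| + `|v|))).
    rewrite !mulrDr mulr1 -addrA; apply: ler_wpDl; first exact: ltW.
    by apply: lerD; rewrite ler_wpM2r // ltW.
  rewrite /h invfM mulrA mulfVK ?gt_eqF // ltr_pdivrMr // ltr_pMr //.
  by rewrite ltr1n.
have [[a b] [/= aP bP e1]] := second_difference x u v h0.
have [[a' b'] [/= aP' bP' e1']] := second_difference x v u h0.
have hn0 : h != 0 by rewrite gt_eqF.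
have e : 'D_v (fun y => 'D_u F y) (x + a *: u + b *: v) =
         'D_u (fun y => 'D_v F y) (x + a' *: v + b' *: u).
  move: e1 e1'; set A := 'D_v _ _; set B := 'D_u _ _; rewrite [x + h *: v + _]addrAC.
  move=> e1 e1'; suff /(mulIf hn0)/(mulIf hn0) : A * h * h = B * h * h by [].
  by apply: (etrans (esym e1)); apply: etrans e1'; congr (_ + _); exact: addrAC.
have [d1 _] := dP _ (near _ _ aP bP).
have [_ d2] := dP _ (near _ _ bP' aP').
move: d1 d2; rewrite /= e [x + b' *: u + _]addrAC; exact: dist_half2.
Qed.

End schwarz_scalar.

Lemma schwarz n (F : U -> 'rV[R]_n) x u v : Ck 2 F ->
  'D_v (fun y => 'D_u F y) x = 'D_u (fun y => 'D_v F y) x.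
Proof.
move=> C2F; apply/rowP => i.
have dv w y : differentiable (fun y => 'D_w F y) y := (C2F.2 w).1 y.
have e w z : 'D_w (fun y => 'D_z F y) x 0 i =
             'D_w (fun y => 'D_z (fun y' => F y' 0 i) y) x.
  rewrite -(derive_coord w i (dv z x)).
  have -> // : (fun y => 'D_z (fun y' => F y' 0 i) y) = (fun y => 'D_z F y 0 i).
  by apply/funext => y; rewrite (derive_coord z i (C2F.1 y)).
have S := schwarz_scalar (Ck_coord (k := 2) i C2F) x u v.
by apply: (etrans (e v u)); apply: (etrans S); apply: esym.
Qed.

(** The derivative of [L] does not depend on the point, so the directional derivatives of the
    composite have the same form and the induction closes. It is meant for [y |-> (y, 0)]. *)
Lemma Ck_comp_affine (U' W : normedModType R) k (F : U -> W) (L : U' -> U)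
    (dL : U' -> U) : (forall x, differentiable L x) ->
  (forall x v, 'D_v L x = dL v) -> Ck k F -> Ck k (fun y => F (L y)).
Proof.
move=> difL LE; elim: k F => [|k IH] F /=.
  move=> cF x; apply: (@continuous_comp _ _ _ L F); last exact: cF.
  exact: differentiable_continuous.
move=> [dF cF]; split=> [x|v].
  exact: (@differentiable_comp _ _ _ _ L F).
have -> : (fun x => 'D_v (fun y => F (L y)) x) = (fun y => 'D_(dL v) F (L y)).
  by apply/funext => x; rewrite derive_comp // LE.
exact: (IH (fun z => 'D_(dL v) F z) (cF _)).
Qed.

End second_derivatives.

Section vector_fields.
Context (R : realType) (n : nat).
Local Notation V := 'rV[R]_n.
Implicit Types (x y u v w : V) (A B Z : V -> V).

Lemma row_sum_basis u : u = \sum_(k < n) u 0 k *: delta_mx 0 k.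
Proof. exact: row_sum_delta. Qed.

Lemma is_derive_scale (U : normedModType R) (k : U -> R) (g : U -> V) (p q : U) (dk : R)
  (dg : V) :
  is_derive p q k dk -> is_derive p q g dg ->
  is_derive p q (fun s => k s *: g s) (dk *: g p + k p *: dg).
Proof.
move=> dk' dg'; apply: is_derive_mx => i.
have := is_deriveM dk' (is_derive_coord i dg').
under [X in _ -> is_derive _ _ X _]eq_fun do rewrite mxE.
move=> h; apply: is_derive_eq h _; rewrite !mxE addrC.
by rewrite -[_ *: dk]/(_ * dk) mulrC.
Qed.

Lemma is_derive_sum_fun (U W : normedModType R) k (h : 'I_k -> U -> W) (p q : U) (dh : 'I_k
  -> W) :
  (forall i, is_derive p q (h i) (dh i)) ->
  is_derive p q (fun s => \sum_(i < k) h i s) (\sum_(i < k) dh i).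
Proof.
move=> dhi; have := is_derive_sum dhi.
by rewrite [X in is_derive _ _ X _](_ : _ = fun s => \sum_(i < k) h i s) //;
  apply/funext => s; rewrite fct_sumE.
Qed.

Definition second_derive B x u w := 'D_u (fun y => 'D_w B y) x.

Lemma is_derive_second_derive B x u w : Ck 2 B -> is_derive x u (fun y =>
  'D_w B y) (second_derive B x u w).
Proof. by move=> C2; apply/derivableP/diff_derivable; exact: (C2.2 w).1. Qed.

(** The direction [A y] moves with [y]; expanding it in the standard basis reduces the claim to the
    product rule. *)
Lemma is_derive_field_deriv A B x u : differentiable A x -> Ck 2 B ->
  is_derive x u (fun y => 'D_(A y) B y) (second_derive B x u (A x) + 'D_('D_u A x) B x).
Proof.
move=> dA C2; have dB y : differentiable B y by exact: C2.1.
have E y w : 'D_w B y = \sum_(k < n) w 0 k *: 'D_(delta_mx 0 k) B y.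
  rewrite {1}(row_sum_basis w) derive_dir_sum //.
  by apply: eq_bigr => k _; rewrite derive_dirZ.
have -> : (fun y => 'D_(A y) B y) =
    (fun y => \sum_(k < n) A y 0 k *: 'D_(delta_mx 0 k) B y).
  by apply/funext => y; rewrite E.
have -> : second_derive B x u (A x) = \sum_(k < n) A x 0 k *: second_derive B x u (delta_mx 0 k).
  apply: is_derive_unique (is_derive_second_derive x u (A x) C2) _.
  have -> : (fun y => 'D_(A x) B y) = (fun y => \sum_(k < n) A x 0 k *: 'D_(delta_mx 0 k) B y).
    by apply/funext => y; rewrite E.
  apply: is_derive_sum_fun => k; apply: is_deriveZ; exact: is_derive_second_derive.
rewrite (E x ('D_u A x)) addrC -big_split /=; apply: is_derive_sum_fun => k.
apply: is_derive_scale; last exact: is_derive_second_derive.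
by apply/is_derive_coord/derivableP/diff_derivable.
Qed.

Lemma second_deriveC B x u w : Ck 2 B -> second_derive B x u w = second_derive B x w u.
Proof. by move=> C2; apply: schwarz. Qed.

Lemma is_derive_bracket A B x u : Ck 2 A -> Ck 2 B ->
  is_derive x u (bracket A B)
    (second_derive B x u (A x) + 'D_('D_u A x) B x - (second_derive A x u (B x) + 'D_('D_u
      B x) A x)).
Proof.
move=> CA CB; apply: is_deriveB; apply: is_derive_field_deriv => //.
  exact: CA.1.
exact: CB.1.
Qed.

Lemma derive_dirB (W : normedModType R) (F : V -> W) x u v : differentiable F x ->
  'D_(u - v) F x = 'D_u F x - 'D_v F x.
Proof. by move=> dF; rewrite !(deriveE _ dF) linearB. Qed.

Lemma jacobi_terms p q r s t w k e f : p - q - (r + s - (t + w)) =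
  k + p - (r + e) - (f - w) - (k + q - (t + f) - (e - s)) :> V.
Proof. by apply/rowP => i; rewrite !mxE; ring. Qed.

Lemma bracket_bracketl A B Z x : Ck 2 A -> Ck 2 B -> Ck 2 Z ->
  bracket (bracket A B) Z x =
  'D_('D_(A x) B x) Z x - 'D_('D_(B x) A x) Z x -
  (second_derive B x (Z x) (A x) + 'D_('D_(Z x) A x) B x
   - (second_derive A x (Z x) (B x) + 'D_('D_(Z x) B x) A x)).
Proof.
move=> CA CB CZ; apply: (congr2 (fun a b => a - b)).
  exact: derive_dirB (CZ.1 x).
exact: is_deriveE (is_derive_bracket x (Z x) CA CB).
Qed.

Lemma bracket_bracketr A B Z x : Ck 2 A -> Ck 2 B -> Ck 2 Z ->
  bracket A (bracket B Z) x =
  (second_derive Z x (A x) (B x) + 'D_('D_(A x) B x) Z x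
   - (second_derive B x (A x) (Z x) + 'D_('D_(A x) Z x) B x)) -
  ('D_('D_(B x) Z x) A x - 'D_('D_(Z x) B x) A x).
Proof.
move=> CA CB CZ; apply: (congr2 (fun a b => a - b)); last first.
  exact: derive_dirB (CA.1 x).
exact: is_deriveE (is_derive_bracket x (A x) CB CZ).
Qed.

(** Once both sides are expanded, the terms with only first derivatives match formally, and those
    with second derivatives match by symmetry. *)
Lemma jacobi A B Z : Ck 2 A -> Ck 2 B -> Ck 2 Z ->
  bracket (bracket A B) Z = bracket A (bracket B Z) - bracket B (bracket A Z).
Proof.
move=> CA CB CZ; apply/funext => x.
rewrite -[RHS]/(bracket A (bracket B Z) x - bracket B (bracket A Z) x).
rewrite (bracket_bracketl x CA CB CZ) (bracket_bracketr x CA CB CZ).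
rewrite (bracket_bracketr x CB CA CZ).
rewrite (second_deriveC x (B x) (A x) CZ) (second_deriveC x (Z x) (A x) CB) (second_deriveC
  x (Z x) (B x) CA).
exact: jacobi_terms.
Qed.

End vector_fields.

(** * The stratified Lie algebra *)

Section lie_bracket.
Context (R : realType) (m r : nat) (G : carnotGroup R m r).
Local Notation n := (m + r)%N.
Local Notation V := 'rV[R]_(m + r).
Local Notation fc := (frame_comb (cg_X G)).
Local Notation deg := (cg_deg G).
Local Notation step := (cg_step G).
Implicit Types (x y z a b c u v w : V) (t s : R).

(** [fc a] is a partial derivative of the product along the points [(y, 0)], so it inherits
    smoothness. *)
Lemma Ck_frame_comb k a : Ck k (fc a).
Proof.
rewrite (_ : fc a = fun y => 'D_(0, a) (fun p : V * V => lg_mul G p.1 p.2) (y, 0)); last first.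
  by apply/funext => y; rewrite frame_comb_dmul2.
apply: (@Ck_comp_affine _ _ _ _ k (fun p => 'D_(0, a) (fun p : V * V => lg_mul G p.1 p.2) p)
    (fun y : V => (y, 0 : V)) (fun v => (v, 0))).
- by move=> x; exact: differentiable_pair.
- move=> x v; have dp : differentiable (fun y : V => (y, 0 : V)) x by exact: differentiable_pair.
  have h := is_diff_pair (is_diff_id x) (is_diff_cst (0 : V) x).
  by rewrite (deriveE _ dp) (@diff_val _ _ _ _ _ _ _ h).
- exact: (lg_smooth_mul G k.+1).2.
Qed.

Lemma differentiable_frame_comb a x : differentiable (fc a) x.
Proof. exact: (Ck_frame_comb 1 a).1. Qed.
Hint Resolve differentiable_frame_comb : core.

Lemma frame_comb_delta j : fc (delta_mx 0 j) = cg_X G j.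
Proof.
apply/funext => y; rewrite /frame_comb (bigD1 j) //= mxE !eqxx scale1r big1 ?addr0 //.
by move=> i ij; rewrite mxE (negbTE ij) andbF scale0r.
Qed.

Lemma frame_comb_zero y : fc 0 y = 0.
Proof. by rewrite /frame_comb big1 // => i _; rewrite mxE scale0r. Qed.

Lemma frame_comb_sum k (c : 'I_k -> R) (e : 'I_k -> V) y :
  fc (\sum_(i < k) c i *: e i) y = \sum_(i < k) c i *: fc (e i) y.
Proof.
rewrite (big_morph (fun a => fc a y) (fun a b => frame_combD G a b y) (frame_comb_zero y)).
by apply: eq_bigr => i _; rewrite frame_combZ.
Qed.

Lemma frame_combN a y : fc (- a) y = - fc a y.
Proof. by rewrite -scaleN1r frame_combZ scaleN1r. Qed.

Definition in_layer i a := forall j, deg j <> i -> a 0 j = 0.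

Lemma in_layer_sum i k (c : 'I_k -> R) (e : 'I_k -> V) :
  (forall l, in_layer i (e l)) -> in_layer i (\sum_(l < k) c l *: e l).
Proof.
move=> H j ji; rewrite summxE big1 // => l _.
by rewrite mxE H // mulr0.
Qed.

Lemma in_layer_delta j : in_layer (deg j) (delta_mx 0 j).
Proof.
move=> k jk; rewrite mxE /=; case: eqP => // e.
by case: jk; rewrite e.
Qed.

Lemma layerP i (Y : V -> V) :
  layer (cg_X G) deg i Y <-> exists2 a, in_layer i a & Y = fc a.
Proof.
split=> [[k [c [Z [ZP ->]]]]|[a aP ->]].
  have {ZP} /choice[f fP] l : exists j, deg j = i /\ Z l = cg_X G j.
    by have [j ? ?] := ZP l; exists j.
  exists (\sum_(l < k) c l *: delta_mx 0 (f l)).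
    by apply: in_layer_sum => l; rewrite -(fP l).1; exact: in_layer_delta.
  apply/funext => y; rewrite frame_comb_sum; apply: eq_bigr => l _.
  by rewrite frame_comb_delta (fP l).2.
pose A := [pred j | deg j == i].
exists #|A|, (fun l => a 0 (enum_val l)), (fun l => cg_X G (enum_val l)); split.
  by move=> l; exists (enum_val l) => //; apply/eqP; exact: (enum_valP l).
apply/funext => y; rewrite -(big_enum_val (A := mem A) (fun j => a 0 j *: cg_X G j y)).
rewrite /frame_comb (bigID (mem A)) /= [X in _ + X]big1 ?addr0 // => j /eqP jA.
by rewrite aP // scale0r.
Qed.

Lemma in_layer_gt_step i a : (step < i)%N -> in_layer i a -> a = 0.
Proof.
move=> si aP; apply/rowP => j; rewrite mxE; apply: aP => e.
by have := cg_deg_range G j; rewrite e => /andP[_]; rewrite leqNgt si.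
Qed.

Lemma bracketC (A B : V -> V) x : bracket A B x = - bracket B A x.
Proof. by rewrite /bracket opprB. Qed.

Lemma bracket_frameDl a b c x :
  bracket (fc (a + b)) (fc c) x = bracket (fc a) (fc c) x + bracket (fc b) (fc c) x.
Proof.
rewrite /bracket frame_combD derive_dirD //.
have -> : fc (a + b) = fc a + fc b by apply/funext => y; rewrite frame_combD.
rewrite deriveD; [|exact: diff_derivable..].
by rewrite opprD addrACA.
Qed.

Lemma bracket_frameZl s a c x :
  bracket (fc (s *: a)) (fc c) x = s *: bracket (fc a) (fc c) x.
Proof.
rewrite /bracket frame_combZ derive_dirZ //.
have -> : fc (s *: a) = s \*: fc a by apply/funext => y; rewrite frame_combZ.
rewrite deriveZ; last exact: diff_derivable.
by rewrite scalerBr.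
Qed.

Lemma bracket_frame_suml k (d : 'I_k -> R) (e : 'I_k -> V) c x :
  bracket (fc (\sum_(i < k) d i *: e i)) (fc c) x =
  \sum_(i < k) d i *: bracket (fc (e i)) (fc c) x.
Proof.
have f0 : bracket (fc 0) (fc c) x = 0.
  by have := bracket_frameZl 0 0 c x; rewrite !scale0r.
rewrite (big_morph (fun a => bracket (fc a) (fc c) x)
  (fun a b => bracket_frameDl a b c x) f0).
by apply: eq_bigr => i _; rewrite bracket_frameZl.
Qed.

Lemma bracket_frame_sumr k (d : 'I_k -> R) (e : 'I_k -> V) c x :
  bracket (fc c) (fc (\sum_(i < k) d i *: e i)) x =
  \sum_(i < k) d i *: bracket (fc c) (fc (e i)) x.
Proof.
rewrite bracketC bracket_frame_suml -sumrN; apply: eq_bigr => i _.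
by rewrite -scalerN -bracketC.
Qed.

Lemma bracket_frame0l a : bracket (fc 0) (fc a) = fc 0.
Proof.
apply/funext => x; have := bracket_frameZl 0 0 a x.
by rewrite !scale0r frame_comb_zero.
Qed.

Lemma bracket_frame0r a : bracket (fc a) (fc 0) = fc 0.
Proof.
apply/funext => x; rewrite bracketC bracket_frame0l.
by rewrite frame_comb_zero oppr0.
Qed.

(** [cg_stratified] covers [i < step] and [cg_last_layer] the case [i = step]; beyond [step] the
    layer is zero. *)
Lemma bracket_layer1 i a b : (0 < i)%N -> in_layer 1 a -> in_layer i b ->
  exists2 c, in_layer i.+1 c & bracket (fc a) (fc b) = fc c.
Proof.
move=> i0 aP bP.
have bs : bracket_span (layer (cg_X G) deg 1) (layer (cg_X G) deg i) (bracket (fc a) (fc b)).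
  exists 1%N, (fun=> 1), (fun=> bracket (fc a) (fc b)); split.
    by move=> _; exists (fc a), (fc b); split => //; apply/layerP; [exists a|exists b].
  by apply/funext => y; rewrite big_ord1 scale1r.
have [si|si|si] := ltngtP i step.
- by move: bs; rewrite (cg_stratified (c := G)) ?i0 // => /layerP[c ? ?]; exists c.
- have -> := in_layer_gt_step si bP; exists 0; last exact: bracket_frame0r.
  by move=> j _; rewrite mxE.
- move: bs; rewrite si cg_last_layer => ->; exists 0; first by move=> j _; rewrite mxE.
  by apply/funext => y; rewrite frame_comb_zero.
Qed.

(** Only brackets with [V_1] are prescribed. An element of layer [i + 1] is a combination of
    brackets [[u, v]] with [u] in layer [1] and [v] in layer [i], and [[[u, v], b] = [u, [v, b]] -
    [v, [u, b]]], where the induction on [i], for all [j] and [b], handles the brackets with [v]. *)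
Lemma bracket_layer i j a b : (0 < i)%N -> (0 < j)%N -> in_layer i a -> in_layer j b ->
  exists2 c, in_layer (i + j) c & bracket (fc a) (fc b) = fc c.
Proof.
elim: i j a b => [//|i IH] j a b _ j0 aP bP.
have [i0|i0] := posnP i; first by rewrite i0 in aP *; exact: bracket_layer1.
have [si|si] := leqP step i.
  have -> := in_layer_gt_step _ aP; last by [].
  by exists 0; [move=> k _; rewrite mxE|exact: bracket_frame0l].
have : layer (cg_X G) deg i.+1 (fc a) by apply/layerP; exists a.
rewrite -(cg_stratified (c := G)) ?i0 // => -[k [d [Z [ZP e]]]].
have {ZP} /choice[f fP] l : exists p : V * V,
    [/\ in_layer i.+1 p.1, Z l = fc p.1, in_layer (i.+1 + j) p.2 &
     bracket (fc p.1) (fc b) = fc p.2].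
  have [_ [_ [/layerP[u uP ->] /layerP[v vP ->] ZE]]] := ZP l.
  have [w wP wE] := bracket_layer1 i0 uP vP.
  have [w1 w1P w1E] := IH j _ _ i0 j0 vP bP.
  have [w2 w2P w2E] := bracket_layer1 j0 uP bP.
  have [w3 w3P w3E] := bracket_layer1 (ltn_addr j i0) uP w1P.
  have [w4 w4P w4E] := IH j.+1 _ _ i0 isT vP w2P.
  exists (w, w3 - w4); split=> /=.
  - exact: wP.
  - by rewrite ZE.
  - move=> q qP; rewrite !mxE w3P 1?w4P ?subrr //; first by rewrite addnS -addSn.
  - rewrite -wE jacobi; [|exact: Ck_frame_comb..].
    rewrite w1E w2E w3E w4E; apply/funext => y.
    by rewrite frame_combD frame_combN.
exists (\sum_(l < k) d l *: (f l).2).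
  by apply: in_layer_sum => l; case: (fP l).
have -> : a = \sum_(l < k) d l *: (f l).1.
  apply: (@frame_comb_inj _ _ _ G _ _ 0).
  rewrite frame_comb_sum e; apply: eq_bigr => l _.
  by have [_ -> _ _] := fP l.
apply/funext => y; rewrite bracket_frame_suml frame_comb_sum.
by apply: eq_bigr => l _; have [_ _ _ ->] := fP l.
Qed.

(** The Lie algebra bracket carried over to row vectors, a left invariant field being identified
    with its value at the identity. *)
Definition lie a b := bracket (fc a) (fc b) 0.

Lemma lie_delta i j : in_layer (deg i + deg j) (lie (delta_mx 0 i) (delta_mx 0 j)) /\
  bracket (fc (delta_mx 0 i)) (fc (delta_mx 0 j)) =
  fc (lie (delta_mx 0 i) (delta_mx 0 j)).
Proof.
have /andP[di _] := cg_deg_range G i; have /andP[dj _] := cg_deg_range G j.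
have [c cP e] := bracket_layer di dj (@in_layer_delta i) (@in_layer_delta j).
by rewrite /lie e frame_comb0.
Qed.

Lemma bracket_basis a b x : bracket (fc a) (fc b) x =
  \sum_(i < n) a 0 i *: \sum_(j < n) b 0 j *: bracket (fc (delta_mx 0 i)) (fc (delta_mx 0 j)) x.
Proof.
rewrite {1}[in LHS](row_sum_basis a) bracket_frame_suml; apply: eq_bigr => i _.
by rewrite -bracket_frame_sumr -row_sum_basis.
Qed.

(** Closure of the left invariant fields under brackets is read off the stratification: it holds for
    pairs of basis fields and extends bilinearly. *)
Lemma bracket_lie a b : bracket (fc a) (fc b) = fc (lie a b).
Proof.
apply/funext => x; rewrite /lie !bracket_basis frame_comb_sum.
apply: eq_bigr => i _; congr (_ *: _); rewrite frame_comb_sum.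
apply: eq_bigr => j _; congr (_ *: _).
exact: (congr1 (fun F => F x) (lie_delta i j).2).
Qed.

Lemma lie_basis a b : lie a b =
  \sum_(i < n) a 0 i *: \sum_(j < n) b 0 j *: lie (delta_mx 0 i) (delta_mx 0 j).
Proof. exact: bracket_basis. Qed.

(** All degrees are at least [1], so [lie a] strictly raises degrees. This triangular shape is what
    makes the coframe equation solvable coordinate by coordinate. *)
Lemma lie_coord0 a b k : (forall j, (deg j < deg k)%N -> b 0 j = 0) ->
  lie a b 0 k = 0.
Proof.
move=> bk; rewrite lie_basis summxE big1 // => i _; rewrite mxE summxE big1 ?mulr0 //.
move=> j _; rewrite mxE; have [/bk->|jk] := ltnP (deg j) (deg k); first by rewrite mul0r.
rewrite (lie_delta i j).1 ?mulr0 // => e.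
have /andP[di _] := cg_deg_range G i.
by move: jk; rewrite e leqNgt -[X in (X < _)%N]add0n ltn_add2r di.
Qed.

Lemma dilE t a j : dil G t a 0 j = t ^+ deg j * a 0 j.
Proof. by rewrite mxE. Qed.

Lemma dilD t a b : dil G t (a + b) = dil G t a + dil G t b.
Proof. by apply/rowP => j; rewrite !mxE mulrDr. Qed.

Lemma dilZ t s a : dil G t (s *: a) = s *: dil G t a.
Proof. by apply/rowP => j; rewrite !mxE mulrCA. Qed.

Lemma dil_layer t i a : in_layer i a -> dil G t a = t ^+ i *: a.
Proof.
move=> aP; apply/rowP => j; rewrite !mxE.
by have [->//|/eqP/aP ->] := eqVneq (deg j) i; rewrite !mulr0.
Qed.

Lemma dil_sum t k (c : 'I_k -> R) (e : 'I_k -> V) :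
  dil G t (\sum_(i < k) c i *: e i) = \sum_(i < k) c i *: dil G t (e i).
Proof.
have d0 : dil G t 0 = 0 by apply/rowP => j; rewrite !mxE mulr0.
rewrite (big_morph (dil G t) (dilD t) d0).
by apply: eq_bigr => i _; rewrite dilZ.
Qed.

Lemma dil_lie t a b : dil G t (lie a b) = lie (dil G t a) (dil G t b).
Proof.
rewrite [in RHS]lie_basis [in LHS]lie_basis dil_sum; apply: eq_bigr => i _.
rewrite dil_sum !scaler_sumr; apply: eq_bigr => j _.
rewrite (dil_layer _ (lie_delta i j).1) !scalerA !dilE exprD; congr (_ *: _).
by ring.
Qed.

End lie_bracket.

(** * Dilations are automorphisms *)

Section dilations.
Context (R : realType) (m r : nat) (G : carnotGroup R m r).
Local Notation n := (m + r)%N.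
Local Notation V := 'rV[R]_(m + r).
Local Notation "x '**' y" := (lg_mul G x y) (at level 40, left associativity).
Local Notation fc := (frame_comb (cg_X G)).
Local Notation deg := (cg_deg G).
Implicit Types (x y z a b c u v w : V) (t s : R).

Lemma is_derive_frame_comb (c g : R -> V) t u v :
  is_derive t 1 c u -> is_derive t 1 g v ->
  is_derive t 1 (fun s => fc (c s) (g s)) (fc u (g t) + 'D_v (fc (c t)) (g t)).
Proof.
move=> dc dg.
have dX j y : differentiable (cg_X G j) y.
  by rewrite -frame_comb_delta; exact: differentiable_frame_comb.
have -> : 'D_v (fc (c t)) (g t) = \sum_(j < n) c t 0 j *: 'D_v (cg_X G j) (g t).
  apply/is_deriveE/is_derive_sum_fun => j; apply: is_deriveZ.
  by apply/derivableP/diff_derivable.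
rewrite -big_split /=; apply: is_derive_sum_fun => j.
by apply: is_derive_scale; [exact: is_derive_coord|exact: is_derive_comp_curve].
Qed.

(* [s v] read in the left-invariant frame at the point [s x]. *)
Definition ray_coframe x v s := s *: dmul2 G (- (s *: x)) (s *: x) v.

Lemma frame_ray_coframe x v s : fc (ray_coframe x v s) (s *: x) = s *: v.
Proof.
rewrite /ray_coframe frame_combZ; congr (_ *: _); rewrite frame_comb_dmul2 -(inv_exp G).
have := dmul2_assoc G (s *: x) (lg_inv G (s *: x)) (s *: x) v.
by rewrite lg_mulgV lg_mulVg dmul2_1.
Qed.

Lemma differentiable_ray_coframe x v s : differentiable (ray_coframe x v) s.
Proof.
have d1 : is_derive s 1 (fun s => (- (s *: x), s *: x)) (- x, x).
  apply: is_derive_pair (is_derive_ray x s).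
  by apply: is_deriveN; exact: is_derive_ray.
have d2 := is_derive_comp_curve d1 (((lg_smooth_mul G 2).2 (0, v)).1 _).
exact: is_derive_curve_differentiable (is_derive_scale (is_derive_id s 1) d2).
Qed.

(** Differentiate [fc y y = y], which says that rays are integral curves, at [y = s *: x] in the
    direction [v]. *)
Lemma radial_derive x v s : s *: 'D_v (fc x) (s *: x) = v - fc v (s *: x).
Proof.
have dl := is_derive_line (s *: x) v 0.
have := is_derive_frame_comb dl dl; rewrite !scale0r !addr0.
have -> : (fun t => fc (s *: x + t *: v) (s *: x + t *: v)) = (fun t => s *: x + t *: v).
  by apply/funext => t; have := exp_ray G (s *: x + t *: v) 1; rewrite scale1r.
move=> /(is_derive_unique dl) e.
have <- : 'D_v (fc (s *: x)) (s *: x) = s *: 'D_v (fc x) (s *: x).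
  have -> : fc (s *: x) = s \*: fc x by apply/funext => y; rewrite frame_combZ.
  by rewrite deriveZ //; exact/diff_derivable/differentiable_frame_comb.
by apply/eqP; rewrite eq_sym subr_eq addrC; apply/eqP.
Qed.

(** Differentiating [fc (J s) (s *: x) = s *: v] gives [fc J' = v - D_x (fc J)] at [s *: x]. There
    the bracket of [fc x] and [fc J] equals [D_x (fc J) - s D_v (fc x)], whose last term is known
    from [radial_derive]. *)
Lemma is_derive_ray_coframe x v s :
  is_derive s 1 (ray_coframe x v) (v - lie G x (ray_coframe x v s)).
Proof.
set J := ray_coframe x v.
have dJ : is_derive s 1 J ('D_1 J s).
  exact/differentiable_is_derive/differentiable_ray_coframe.
have := is_derive_frame_comb dJ (is_derive_ray x s).
have -> : (fun t => fc (J t) (t *: x)) = (fun t => t *: v).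
  by apply/funext => t; exact: frame_ray_coframe.
move=> /(is_derive_unique (is_derive_ray v s)) e.
have b : bracket (fc x) (fc (J s)) (s *: x) = fc (lie G x (J s)) (s *: x).
  by rewrite bracket_lie.
move: b; rewrite /bracket exp_ray frame_ray_coframe.
rewrite derive_dirZ; last exact: differentiable_frame_comb.
rewrite radial_derive => b.
suff -> : v - lie G x (J s) = 'D_1 J s by [].
apply: (@frame_comb_inj _ _ _ G _ _ (s *: x)).
rewrite frame_combD frame_combN -b; apply: (addIr ('D_x (fc (J s)) (s *: x))).
by rewrite -e opprB addrA subrK addrC subrK.
Qed.

Lemma ray_coframe0 x v : ray_coframe x v 0 = 0.
Proof. by rewrite /ray_coframe scale0r. Qed.

Lemma ray_coframe_frame x w : ray_coframe x (fc w x) 1 = w.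
Proof.
rewrite /ray_coframe !scale1r frame_comb_dmul2 -(inv_exp G).
by have := dmul2K G x 0 w; rewrite lg_mulg0.
Qed.

Lemma scalar_derive0_cst (g : R -> R) (d : R) : (forall t : R, is_derive t 1 g d) ->
  forall t, g t = g 0 + t * d.
Proof.
move=> dg t; apply/eqP; rewrite -subr_eq; apply/eqP.
rewrite -[RHS]subr0 -[X in _ = _ - X](mul0r d).
apply: (@is_derive_0_is_cst R (fun s => g s - s * d)) => s.
have h := is_deriveB (dg s) (is_derive_ray (d : R^o) s).
by apply: is_derive_eq h _; rewrite subrr.
Qed.

Lemma deg_horizontal (k : 'I_m) : deg (lshift r k) = 1%N.
Proof. by apply/eqP; rewrite cg_deg1 /= ltn_ord. Qed.

(** In a coordinate [k] of degree [1] the bracket term of the coframe equation vanishes, so [J_k]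
    grows at the constant rate [v_k]. Take [v = fc w x], for which [J] is [w] at time [1]. *)
Lemma horproj_frame_comb w x (k : 'I_m) : fc w x 0 (lshift r k) = w 0 (lshift r k).
Proof.
have d s : is_derive s 1 (fun s => ray_coframe x (fc w x) s 0 (lshift r k))
    (fc w x 0 (lshift r k)).
  have := is_derive_coord (lshift r k) (is_derive_ray_coframe x (fc w x) s).
  rewrite [X in is_derive _ _ _ X]mxE [X in _ + X]mxE lie_coord0 ?subr0 // => j;
    rewrite deg_horizontal ltnS leqn0 => /eqP e.
  by have := cg_deg_range G j; rewrite e.
have := scalar_derive0_cst d 1.
by rewrite ray_coframe_frame ray_coframe0 mxE add0r mul1r.
Qed.

Lemma horproj_mul x y : horproj (x ** y) = horproj x + horproj y.
Proof.
apply/rowP => k; rewrite !mxE.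
have d s : is_derive s 1 (fun s => (x ** (s *: y)) 0 (lshift r k)) (y 0 (lshift r k)).
  have := is_derive_coord (lshift r k) (is_derive_exp_curve G x y s).
  by rewrite horproj_frame_comb.
by have := scalar_derive0_cst d 1; rewrite scale1r scale0r lg_mulg0 mul1r.
Qed.

Lemma is_derive_dil t (g : R -> V) s v : is_derive s 1 g v ->
  is_derive s 1 (fun q => dil G t (g q)) (dil G t v).
Proof.
move=> dg; apply: is_derive_mx => i; rewrite dilE.
under eq_fun do rewrite dilE.
exact: is_deriveZ (is_derive_coord i dg).
Qed.

Lemma lieBr a b c : lie G a (b - c) = lie G a b - lie G a c.
Proof.
have e : bracket (fc (b - c)) (fc a) 0 = bracket (fc b) (fc a) 0 - bracket (fc c) (fc a) 0.
  by rewrite bracket_frameDl -scaleN1r bracket_frameZl scaleN1r.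
by rewrite /lie bracketC e opprB [in RHS]bracketC (bracketC (fc a)) opprK addrC.
Qed.

Lemma subrBB u v w : u - v - (u - w) = - (v - w).
Proof. by rewrite !opprB addrC addrA subrK. Qed.

(** The difference [K] of the two sides solves [K' = - [dil t x, K]] with [K 0 = 0]. The derivative
    of a coordinate of [K] involves only coordinates of lower degree, so [K] vanishes by induction
    on the degree. *)
Lemma ray_coframe_dil t x v s :
  ray_coframe (dil G t x) (dil G t v) s = dil G t (ray_coframe x v s).
Proof.
pose K s := ray_coframe (dil G t x) (dil G t v) s - dil G t (ray_coframe x v s).
have dilN u : dil G t (- u) = - dil G t u by rewrite -scaleN1r dilZ scaleN1r.
have dK (q : R) : is_derive q 1 K (- lie G (dil G t x) (K q)).
  have h := is_deriveB (is_derive_ray_coframe (dil G t x) (dil G t v) q)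
    (is_derive_dil t (is_derive_ray_coframe x v q)).
  apply: is_derive_eq h _.
  have -> : dil G t (v - lie G x (ray_coframe x v q)) =
      dil G t v - lie G (dil G t x) (dil G t (ray_coframe x v q)).
    by rewrite dilD dilN dil_lie.
  have -> := lieBr (dil G t x) (ray_coframe (dil G t x) (dil G t v) q) (dil G t
    (ray_coframe x v q)).
  exact: subrBB.
have K0 N : forall k, (deg k < N)%N -> forall q, K q 0 k = 0.
  elim: N => [//|N IH] k kN q.
  have d (b : R) : is_derive b 1 (fun q => K q 0 k) 0.
    have := is_derive_coord k (dK b).
    rewrite [X in is_derive _ _ _ X]mxE lie_coord0 ?oppr0 // => j jk.
    by apply: IH; exact: leq_trans jk _.
  have := scalar_derive0_cst d q.
  by rewrite /K !ray_coframe0 !mxE !mulr0 subrr add0r.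
apply/rowP => k; apply/eqP; rewrite -subr_eq0; apply/eqP.
by have := K0 (deg k).+1 k (leqnn _) s; rewrite !mxE.
Qed.

Lemma dil_frame_comb t w x : dil G t (fc w x) = fc (dil G t w) (dil G t x).
Proof.
have := ray_coframe_dil t x (fc w x) 1; rewrite ray_coframe_frame => e.
have := frame_ray_coframe (dil G t x) (dil G t (fc w x)) 1.
by rewrite e !scale1r.
Qed.

(** With [s *: y] in place of [y], both sides are integral curves in [s] of [fc (dil t y)] that
    start at [dil t x]. *)
Lemma dil_mul t x y : dil G t (x ** y) = dil G t x ** dil G t y.
Proof.
rewrite -[in LHS](scale1r y) -[in RHS](scale1r (dil G t y)).
apply: (frame_curve_unique (G := G) (a := dil G t y) (g1 := fun s => dil G t (x ** (s *: y)))
   (g2 := fun s => dil G t x ** (s *: dil G t y))) => [s|s|].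
- by rewrite -dil_frame_comb; apply: is_derive_dil; exact: is_derive_exp_curve.
- exact: is_derive_exp_curve.
- by rewrite !scale0r !lg_mulg0.
Qed.

Lemma dilM s t x : dil G s (dil G t x) = dil G (s * t) x.
Proof. by apply/rowP => k; rewrite !mxE exprMn mulrA. Qed.

Lemma dil1 x : dil G 1 x = x.
Proof. by apply/rowP => k; rewrite !mxE expr1n mul1r. Qed.

Lemma dil_exp_V1 t (e : 'rV[R]_m) : dil G t (exp_V1 r e) = exp_V1 r (t *: e).
Proof.
apply/rowP => j; rewrite !mxE; case: splitP => k jk; rewrite !mxE ?mulr0 //.
suff -> : j = lshift r k by rewrite deg_horizontal expr1.
exact/val_inj.
Qed.

End dilations.

(** * Chow's theorem *)

Section horizontal_span.
Context (R : realType) (m r : nat) (G : carnotGroup R m r).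
Local Notation n := (m + r)%N.
Local Notation V := 'rV[R]_(m + r).
Local Notation "x '**' y" := (lg_mul G x y) (at level 40, left associativity).
Local Notation inv := (lg_inv G).
Local Notation fc := (frame_comb (cg_X G)).
Local Notation deg := (cg_deg G).
Local Notation step := (cg_step G).
Implicit Types (x y z u v w : V) (s t : R) (e : 'rV[R]_m).

(** By symmetry of second derivatives, the derivative in the second factor, which produces the
    frame, may be taken first. *)
Lemma derive_frame_second x w :
  'D_(0, x) (fun p => 'D_(w, 0) (fun p : V * V => p.1 ** p.2) p) (0, 0) = 'D_w (fc x) 0.
Proof.
have C2 := lg_smooth_mul G 2.
rewrite -(schwarz (0, 0) (0, x) (w, 0) C2).
have d1 : is_derive (0 : R) 1 (fun t : R => (0 + t *: w, 0 : V)) (w, 0).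
  exact: is_derive_pair (is_derive_line 0 w 0) (is_derive_cst _ _ _).
have := is_derive_comp_curve d1 ((C2.2 (0, x)).1 _).
have := derive_along_line w (differentiable_frame_comb G x 0).
under eq_fun do rewrite frame_comb_dmul2.
move=> h1; rewrite scale0r addr0 => h2; exact: is_derive_unique h2 h1.
Qed.

(** Left translation of [w] to [t *: x] agrees with right translation of its conjugate:
    [fc w (t *: x) = dmul1 0 (t *: x) (c t)]. At [t = 0] the left side has derivative [D_x (fc w)]
    and the right side [c' + D_w (fc x)], so [c'] is the bracket. *)
Lemma is_derive_conj x w :
  is_derive (0 : R) 1 (fun t => (t *: x) ** w ** inv (t *: x)) (lie G x w).
Proof.
set c := fun t => _.
have dx := is_derive_ray x 0.
have [c' dc] : exists c', is_derive (0 : R) 1 c c'.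
  eexists; apply: is_derive_mul (is_derive_mull G w dx) _.
  exact: is_derive_comp_curve dx (differentiable_inv G _).
have c0 : c 0 = w by rewrite /c scale0r lg_inv0 lg_mulg0 lg_mul0g.
have E t : fc w (t *: x) = dmul1 G 0 (t *: x) (c t).
  have h1 := is_derive_mulr G (t *: x) (is_derive_ray w 0).
  have h2 := is_derive_mull G (t *: x) (is_derive_ray (c t) 0).
  move: h1 h2; rewrite !scale0r -frame_comb_dmul2 => h1 h2.
  apply: is_derive_unique h1 _.
  rewrite (_ : (fun s => _) = (fun s => (s *: c t) ** (t *: x))) //.
  by apply/funext => s; rewrite -conj_exp -!lg_mulA lg_mulVg lg_mulg0.
have E1 t : dmul1 G 0 (t *: x) (c t) =
    \sum_(k < n) c t 0 k *: dmul1 G 0 (t *: x) (delta_mx 0 k).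
  rewrite {1}(row_sum_basis (c t)).
  rewrite (big_morph _ (dmul1D G 0 (t *: x)) (dmul1_0 G 0 (t *: x))).
  by apply: eq_bigr => k _; rewrite dmul1Z.
have d1 : is_derive (0 : R) 1 (fun t => (0 : V, t *: x)) (0, x).
  exact: is_derive_pair (is_derive_cst _ _ _) dx.
have d2 k := is_derive_comp_curve d1 (((lg_smooth_mul G 2).2 (delta_mx 0 k, 0)).1 _).
have h1 : is_derive (0 : R) 1 (fun t => fc w (t *: x)) ('D_x (fc w) 0).
  have := derive_along_line x (differentiable_frame_comb G w 0).
  by under eq_fun do rewrite add0r.
have h2 := is_derive_sum_fun (fun k => is_derive_scale (is_derive_coord k dc) (d2 k)).
have e : (fun t => fc w (t *: x)) = (fun t => \sum_(k < n) c t 0 k *: dmul1 G 0 (t *: x)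
  (delta_mx 0 k)).
  by apply/funext => t; rewrite E E1.
move: h1; rewrite e => /is_derive_unique /(_ h2).
rewrite big_split /= scale0r c0.
have -> : \sum_(i < n) c' 0 i *: 'D_(delta_mx 0 i, 0) (fun p : V * V => p.1 ** p.2) (0, 0) = c'.
  rewrite [RHS]row_sum_basis; apply: eq_bigr => k _.
  by congr (_ *: _); exact: dmul1_1.
have -> : \sum_(i < n) w 0 i *: 'D_(0, x) (fun p => 'D_(delta_mx 0 i, 0) (fun p : V * V =>
  p.1 ** p.2) p) (0, 0)
   = 'D_w (fc x) 0.
  rewrite [in RHS](row_sum_basis w) derive_dir_sum; last exact: differentiable_frame_comb.
  apply: eq_bigr => k _; rewrite derive_dirZ; last exact: differentiable_frame_comb.
  by rewrite -derive_frame_second.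
move=> e'; suff -> : lie G x w = c' by [].
by rewrite /lie /bracket !frame_comb0 e' addrK.
Qed.

Definition hprod (l : seq 'rV[R]_m) : V := foldr (fun e z => exp_V1 r e ** z) 0 l.

Lemma hprod_cat l1 l2 : hprod (l1 ++ l2) = hprod l1 ** hprod l2.
Proof. by elim: l1 => [|e l IH] /=; rewrite ?lg_mul0g // IH lg_mulA. Qed.

Lemma exp_V1Z t e : exp_V1 r (t *: e) = t *: exp_V1 r e.
Proof. by rewrite /exp_V1 scale_row_mx scaler0. Qed.

Lemma exp_V1N e : exp_V1 r (- e) = - exp_V1 r e.
Proof. by rewrite -scaleN1r exp_V1Z scaleN1r. Qed.

Lemma hprod_inv l : hprod (rev (map -%R l)) = inv (hprod l).
Proof.
elim: l => [|e l IH] /=; first by rewrite lg_inv0.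
by rewrite rev_cons -cats1 hprod_cat IH lg_invM /= lg_mulg0 exp_V1N -(inv_exp G).
Qed.

Lemma hprod_dil t l : hprod (map ( *:%R t) l) = dil G t (hprod l).
Proof.
elim: l => [|e l IH] /=; first by apply/rowP => k; rewrite !mxE mulr0.
by rewrite IH dil_mul dil_exp_V1.
Qed.

Definition hconj w := exists l e, w = hprod l ** exp_V1 r e ** inv (hprod l).

(** Take a linearly independent family of conjugates of maximal size; a conjugate outside its row
    space could be added to it. *)
Lemma hconj_spans : exists k (A : 'M[R]_(k, n)),
  (forall i, hconj (row i A)) /\ (forall w, hconj w -> (w <= A)%MS).
Proof.
pose P k := `[< exists A : 'M[R]_(k, n), row_free A /\ forall i, hconj (row i A) >].
have P0 : exists k, P k.
  exists 0%N; apply/asboolP; exists 0; split; last by case.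
  by rewrite /row_free mxrank0.
have Pn k : P k -> (k <= n)%N.
  by move=> /asboolP[A [/eqP Af _]]; have := rank_leq_col A; rewrite Af.
case: (ex_maxnP P0 Pn) => k /asboolP[A [Af AP]] kmax.
exists k, A; split => // w wP; apply: contraT => wA.
suff /kmax : P (1 + k)%N by rewrite add1n ltnn.
apply/asboolP; exists (col_mx w A); split; last first.
  move=> i; case: (splitP i) => j ij.
    have -> : i = lshift k j by exact/val_inj.
    by rewrite rowKu ord1 row_id.
  have -> : i = rshift 1 j by exact/val_inj.
  by rewrite rowKd.
rewrite /row_free eqn_leq rank_leq_row /= -addsmxE.
have -> : (1 + k <= \rank (w + A)%MS)%N = (\rank A < \rank (w + A)%MS)%N by rewrite (eqP Af).
apply: rank_ltmx; rewrite /ltmx addsmxSr /=.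
by apply: contra wA; apply: submx_trans; exact: addsmxSl.
Qed.

Lemma in_layer1_exp a : in_layer G 1 a -> a = exp_V1 r (lsubmx a).
Proof.
move=> aP; rewrite -[LHS]hsubmxK; congr row_mx.
apply/rowP => k; rewrite !mxE; apply: aP => /eqP.
by rewrite cg_deg1 /= ltnNge leq_addr.
Qed.

(** For a row [w] of [A], the points [(t *: u) ** w ** inv (t *: u)] are conjugates again, so this
    curve stays in the row space of [A]; hence so does its derivative [lie u w] at [t = 0]. *)
Lemma hconj_lie k (A : 'M[R]_(k, n)) u v :
  (forall i, hconj (row i A)) -> (forall w, hconj w -> (w <= A)%MS) ->
  in_layer G 1 u -> (v <= A)%MS -> (lie G u v <= A)%MS.
Proof.
move=> AP SA uP /submxP[D ->].
rewrite mulmx_sum_row /lie bracket_frame_sumr; apply: summx_sub => i _.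
apply: scalemx_sub; rewrite -/(lie G u (row i A)); set w := row i A.
rewrite submxE; apply/eqP.
(* Membership in the row space is tested by multiplying with [cokermx A], written as a sum over rows
   so that it can be differentiated term by term. *)
have d : is_derive (0 : R) 1
    (fun t => \sum_(j < n) ((t *: u) ** w ** inv (t *: u)) 0 j *: row j (cokermx A))
    (\sum_(j < n) (lie G u w) 0 j *: row j (cokermx A)).
  apply: is_derive_sum_fun => j.
  have := is_derive_scale (is_derive_coord j (is_derive_conj u w)) (is_derive_cst (row j
    (cokermx A)) (0 : R) 1).
  by rewrite scaler0 addr0.
rewrite mulmx_sum_row; apply: is_derive_unique d _.
rewrite [X in is_derive _ _ X _](_ : _ = cst 0); first exact: is_derive_cst.
apply/funext => t; rewrite -mulmx_sum_row; apply/eqP; rewrite -submxE; apply: SA.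
have [l [e lE]] := AP i.
exists (t *: lsubmx u :: l), e.
by rewrite /w lE /= exp_V1Z -(in_layer1_exp uP) lg_invM !lg_mulA.
Qed.

Lemma hconj_full k (A : 'M[R]_(k, n)) :
  (forall i, hconj (row i A)) -> (forall w, hconj w -> (w <= A)%MS) ->
  forall w, (w <= A)%MS.
Proof.
move=> AP SA.
have L i a : in_layer G i.+1 a -> (a <= A)%MS.
  elim: i a => [|i IH] a aP.
    apply: SA; exists [::], (lsubmx a).
    by rewrite /= lg_inv0 lg_mulg0 lg_mul0g; exact: in_layer1_exp.
  have [si|si] := leqP step i.+1.
    by rewrite (in_layer_gt_step _ aP) ?sub0mx.
  have : layer (cg_X G) deg i.+2 (fc a) by apply/layerP; exists a.
  rewrite -(cg_stratified (c := G)) // => -[q [d [Z [ZP e]]]].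
  have -> : a = \sum_(j < q) d j *: Z j 0.
    by rewrite -[LHS](frame_comb0 G) e.
  apply: summx_sub => j _; apply: scalemx_sub.
  have [X [Y [/layerP[u uP ->] /layerP[v vP ->] ->]]] := ZP j.
  by apply: (hconj_lie AP SA uP); exact: IH.
move=> w; rewrite (row_sum_basis w); apply: summx_sub => j _; apply: scalemx_sub.
apply: (L (deg j).-1); have /andP[d0 _] := cg_deg_range G j.
by rewrite prednK //; exact: in_layer_delta.
Qed.

End horizontal_span.

(** * Strict differentiability of the product at the identity *)

Section strict_differentiability.
Context (R : realType).

Lemma coord_le_norm n (x : 'rV[R]_n) i : `|x 0 i| <= `|x|.
Proof.
by rewrite [leRHS]/Num.Def.normr/= mx_normrE; apply: (le_bigmax _ _ (ord0, i)).
Qed.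

Lemma norm_le_coords n (x : 'rV[R]_n) (c : R) : 0 <= c ->
  (forall i, `|x 0 i| <= c) -> `|x| <= c.
Proof.
move=> c0 H; rewrite [leLHS]/Num.Def.normr/= mx_normrE.
by apply: bigmax_le => // -[i j] _ /=; rewrite ord1.
Qed.

Lemma norm_mulmx_le k n (B : 'M[R]_(k, n)) :
  exists2 C : R, 0 < C & forall d : 'rV[R]_k, `|d *m B| <= C * `|d|.
Proof.
pose C := 1 + \sum_(i < k) `|row i B|.
have C0 : 0 < C by rewrite ltr_pwDl // sumr_ge0.
exists C => // d; rewrite mulmx_sum_row.
apply: (le_trans (ler_norm_sum _ _ _)).
rewrite mulrDl mul1r; apply: ler_wpDl => //.
rewrite mulr_suml; apply: ler_sum => i _; rewrite normrZ mulrC.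
by rewrite ler_wpM2l // coord_le_norm.
Qed.

Section multiplication.
Context (n : nat) (G : lieGroup 'rV[R]_n).
Local Notation V := 'rV[R]_n.
Local Notation "x '**' y" := (lg_mul G x y) (at level 40, left associativity).

Let mul_near (eta : R) : 0 < eta -> \forall p \near (0 : V, 0 : V), forall u v,
  `|'D_(u, v) (fun p : V * V => p.1 ** p.2) p - (u + v)| <= eta * (`|u| + `|v|).
Proof.
(* Summing over the [n] basis directions costs a factor [n]; [n.+1] keeps the divisor positive when
   [n = 0]. *)
move=> eta0; pose e1 := eta / n.+1%:R; have e10 : 0 < e1 by rewrite divr_gt0.
have cont w : \forall p \near (0 : V, 0 : V),
    `|'D_w (fun p : V * V => p.1 ** p.2) (0, 0) - 'D_w (fun p : V * V => p.1 ** p.2) p| < e1.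
  by have /cvgrPdist_lt/(_ _ e10) := (lg_smooth_mul G 1).2 w (0, 0).
have c1 : \forall p \near (0 : V, 0 : V), forall k : 'I_n,
    `|dmul1 G p.1 p.2 (delta_mx 0 k) - delta_mx 0 k| < e1.
  have h (k : 'I_n) : \forall p \near (0 : V, 0 : V),
      `|dmul1 G p.1 p.2 (delta_mx 0 k) - delta_mx 0 k| < e1.
    have := cont (delta_mx 0 k, 0).
    have -> : 'D_(delta_mx 0 k, 0) (fun p : V * V => p.1 ** p.2) (0, 0) = delta_mx 0 k.
      exact: dmul1_1.
    by move=> h; apply: filterS h => -[a b]; rewrite distrC.
  exact: filter_forall h.
have c2 : \forall p \near (0 : V, 0 : V), forall k : 'I_n,
    `|dmul2 G p.1 p.2 (delta_mx 0 k) - delta_mx 0 k| < e1.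
  have h (k : 'I_n) : \forall p \near (0 : V, 0 : V),
      `|dmul2 G p.1 p.2 (delta_mx 0 k) - delta_mx 0 k| < e1.
    have := cont (0, delta_mx 0 k).
    have -> : 'D_(0, delta_mx 0 k) (fun p : V * V => p.1 ** p.2) (0, 0) = delta_mx 0 k.
      exact: dmul2_1.
    by move=> h; apply: filterS h => -[a b]; rewrite distrC.
  exact: filter_forall h.
have bound (f : V -> V) u : (forall u v, f (u + v) = f u + f v) ->
    (forall s u, f (s *: u) = s *: f u) ->
    (forall k, `|f (delta_mx 0 k) - delta_mx 0 k| < e1) -> `|f u - u| <= eta * `|u|.
  move=> fD fZ fe.
  have f0 : f 0 = 0 by have := fZ 0 0; rewrite !scale0r.
  have -> : f u - u = \sum_(k < n) u 0 k *: (f (delta_mx 0 k) - delta_mx 0 k).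
    rewrite {1 2}(row_sum_basis u) (big_morph _ fD f0) -sumrB.
    by apply: eq_bigr => k _; rewrite fZ scalerBr.
  apply: (le_trans (ler_norm_sum _ _ _)).
  apply: (@le_trans _ _ (\sum_(k < n) `|u| * e1)).
    apply: ler_sum => k _; rewrite normrZ; apply: ler_pM => //.
      exact: coord_le_norm.
    exact: ltW.
  rewrite sumr_const card_ord -mulrnAr mulrC ler_wpM2r //.
  by rewrite -mulr_natl /e1 mulrCA ger_pMr // ler_pdivrMr // mul1r ler_nat.
apply: filterS2 c1 c2 => -[a b] /= h1 h2 u v.
have -> : 'D_(u, v) (fun p : V * V => p.1 ** p.2) (a, b) = dmul1 G a b u + dmul2 G a b v.
  have := derive_dirD (u, 0 : V) (0, v) (differentiable_mul G (a, b)).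
  by rewrite -[(u, 0) + _]/(u + 0, 0 + v) addr0 add0r.
rewrite opprD addrACA mulrDr; apply: (le_trans (ler_normD _ _)); apply: lerD.
  by apply: bound h1; [exact: dmul1D|exact: dmul1Z].
by apply: bound h2; [exact: dmul2D|exact: dmul2Z].
Qed.

(** At the identity the product has differential [(u, v) |-> u + v], and nearby it stays within
    [eta] of that; the mean value theorem on the segment between the two pairs gives each
    coordinate. *)
Lemma mul_strict (eta : R) : 0 < eta -> exists2 d : R, 0 < d &
  forall a b a' b', `|a| <= d -> `|b| <= d -> `|a'| <= d -> `|b'| <= d ->
  `|a ** b - a' ** b' - ((a - a') + (b - b'))| <= eta * (`|a - a'| + `|b - b'|).
Proof.
move=> eta0; have /nbhs_ballP[d0 /= d00 d0P] := mul_near eta0.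
exists (d0 / 2); first by rewrite divr_gt0.
move=> a b a' b' ha hb ha' hb'.
pose u := a - a'; pose v := b - b'.
apply: norm_le_coords; first by rewrite mulr_ge0 ?addr_ge0 // ltW.
move=> i.
pose y (t : R) := (a' + t *: u, b' + t *: v).
pose g (t : R) := ((y t).1 ** (y t).2) 0 i - t *: (u + v) 0 i.
pose dg (t : R) := ('D_(u, v) (fun p : V * V => p.1 ** p.2) (y t) - (u + v)) 0 i.
have d (t : R) : is_derive t 1 g (dg t).
  rewrite /dg mxE [X in _ + X]mxE; apply: is_deriveB; last exact: is_derive_ray.
  apply: is_derive_coord.
  have dy : is_derive t 1 y (u, v).
    exact: is_derive_pair (is_derive_line a' u t) (is_derive_line b' v t).
  exact: is_derive_comp_curve dy (differentiable_mul G _).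
have [c /andP[c0 c1] e] := MVT_curve ltr01 d.
have -> : (a ** b - a' ** b' - (a - a' + (b - b'))) 0 i = dg c.
  rewrite -[RHS]mulr1 -e /g /y /= !scale1r !scale0r !addr0 /u /v (subrKC a') (subrKC b') subr0.
  by rewrite !mxE addrAC.
apply: le_trans (coord_le_norm _ i) _; apply: d0P.
have seg (p q : V) : `|p| <= d0 / 2 -> `|q| <= d0 / 2 -> ball 0 d0 (q + c *: (p - q)).
  move=> hp hq; rewrite -ball_normE /= sub0r normrN.
  have -> : q + c *: (p - q) = c *: p + (1 - c) *: q.
    by rewrite scalerBr scalerBl scale1r addrC -addrA [- _ + q]addrC.
  apply: le_lt_trans (ler_normD _ _) _; rewrite !normrZ !ger0_norm ?subr_ge0 ?ltW //.
  apply: (@le_lt_trans _ _ (c * (d0 / 2) + (1 - c) * (d0 / 2))).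
    by apply: lerD; apply: ler_wpM2l => //; rewrite ?subr_ge0 ltW.
  by rewrite -mulrDl subrKC mul1r ltr_pdivrMr // ltr_pMr // ltr1n.
by split; apply: seg.
Qed.

End multiplication.
End strict_differentiability.

(** Completeness of the row vectors, for the fixed point theorem in [local_surjection]. *)
HB.instance Definition _ (R : realType) (m n : nat) := Complete.on 'M[R]_(m, n).

(** * Local surjectivity of strictly differentiable maps *)

Section local_surjectivity.
Context (R : realType).

(** Differences are controlled at all pairs of points near [0]: this passes to group products
    through [mul_strict] without computing derivatives away from [0], and it is what makes the map
    of [local_surjection] a contraction. *)
Definition strictly_diff k n (F L : 'rV[R]_k -> 'rV[R]_n) :=
  [/\ F 0 = 0, exists2 C : R, 0 < C & forall d, `|L d| <= C * `|d| &
  forall eps : R, 0 < eps -> exists2 rho : R, 0 < rho &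
    forall s s', `|s| <= rho -> `|s'| <= rho ->
      `|F s - F s' - L (s - s')| <= eps * `|s - s'| ].

Lemma strictly_diff_lip k n (F L : 'rV[R]_k -> 'rV[R]_n) : strictly_diff F L ->
  exists2 C : R, 0 < C & exists2 rho : R, 0 < rho &
    forall s s', `|s| <= rho -> `|s'| <= rho -> `|F s - F s'| <= C * `|s - s'|.
Proof.
move=> [_ [C C0 CP] /(_ 1 ltr01)[rho rho0 H]].
exists (1 + C); first by rewrite addr_gt0.
exists rho => // s s' hs hs'; rewrite -(subrK (L (s - s')) (F s - F s')).
by apply: le_trans (ler_normD _ _) _; rewrite mulrDl lerD // H.
Qed.

Lemma strictly_diff_mul k n (G : lieGroup 'rV[R]_n) (F1 L1 F2 L2 : 'rV[R]_k -> 'rV[R]_n) :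
  strictly_diff F1 L1 -> strictly_diff F2 L2 ->
  strictly_diff (fun s => lg_mul G (F1 s) (F2 s)) (fun d => L1 d + L2 d).
Proof.
move=> S1 S2; split.
- by case: S1 S2 => -> _ _ [-> _ _]; rewrite lg_mul0g.
- case: S1 S2 => _ [C1 C10 H1] _ [_ [C2 C20 H2] _].
  exists (C1 + C2); first by rewrite addr_gt0.
  by move=> d; rewrite mulrDl; apply: le_trans (ler_normD _ _) _; rewrite lerD.
move=> eps eps0.
have [C1 C10 [r1 r10 lip1]] := strictly_diff_lip S1.
have [C2 C20 [r2 r20 lip2]] := strictly_diff_lip S2.
case: S1 S2 => F10 _ H1 [F20 _ H2].
(* Half of [eps] pays for the error of the product, which is [eta] times the increments of the
   factors; a quarter pays for linearizing each factor. The bounds [d / C1] and [d / C2] in [rho]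
   keep the factors where [mul_strict] applies. *)
pose eta := eps / 2 / (C1 + C2).
have C0 : 0 < C1 + C2 by rewrite addr_gt0.
have eta0 : 0 < eta by rewrite !divr_gt0.
have e40 : 0 < eps / 4 by rewrite divr_gt0.
have [d d0 mulP] := mul_strict G eta0.
have [r3 r30 {}H1] := H1 _ e40; have [r4 r40 {}H2] := H2 _ e40.
pose rho := Num.min r1 (Num.min r2 (Num.min r3 (Num.min r4 (Num.min (d / C1) (d / C2))))).
exists rho; first by rewrite !lt_min !divr_gt0 // r10 r20 r30 r40.
move=> s s'; rewrite !le_min.
move=> /and5P[s1 s2 s3 s4 /andP[s5 s6]] /and5P[t1 t2 t3 t4 /andP[t5 t6]].
have small (F : 'rV[R]_k -> 'rV[R]_n) C rr u : F 0 = 0 -> 0 < C -> 0 < rr ->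
    (forall s s', `|s| <= rr -> `|s'| <= rr -> `|F s - F s'| <= C * `|s - s'|) ->
    `|u| <= rr -> `|u| <= d / C -> `|F u| <= d.
  move=> F0 C0' rr0 lip ur uC; have := lip u 0 ur.
  rewrite normr0 F0 !subr0 => /(_ (ltW rr0)) /le_trans; apply.
  by rewrite mulrC -ler_pdivlMr.
have := mulP _ _ _ _ (small F1 _ _ _ F10 C10 r10 lip1 s1 s5) (small F2 _ _ _ F20 C20 r20
  lip2 s2 s6)
  (small F1 _ _ _ F10 C10 r10 lip1 t1 t5) (small F2 _ _ _ F20 C20 r20 lip2 t2 t6).
rewrite /=; have := lip1 _ _ s1 t1; have := lip2 _ _ s2 t2.
have := H1 _ _ s3 t3; have := H2 _ _ s4 t4.
move: (L1 _) (L2 _) (lg_mul _ _ _) (lg_mul _ _ _) => l1 l2 m2 m1.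
move: (F1 s - F1 s') (F2 s - F2 s') `|s - s'| (normr_ge0 (s - s')) => f1 f2 N N0 h2 h1 p2 p1 q.
have -> : m1 - m2 - (l1 + l2) = (m1 - m2 - (f1 + f2)) + (f1 - l1) + (f2 - l2).
  by apply/rowP => i; rewrite !mxE; ring.
apply: le_trans (ler_normD _ _) _.
apply: le_trans (lerD (ler_normD _ _) h2) _.
apply: le_trans (lerD (lerD q h1) (lexx _)) _.
have q2 : eta * (`|f1| + `|f2|) <= eps / 2 * N.
  apply: (@le_trans _ _ (eta * ((C1 + C2) * N))).
    by rewrite ler_wpM2l ?(ltW eta0) // mulrDl lerD.
  by rewrite mulrA /eta mulfVK // gt_eqF.
apply: le_trans (lerD (lerD q2 (lexx _)) (lexx _)) _.
by rewrite -!mulrDl ler_wpM2r //; lra.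
Qed.

(** Solve [s = T s] for [T s = (z - (F s - s *m A)) *m P]. Multiplied by [A], this equation reads
    [s *m A = z - (F s - s *m A)], that is [F s = z]. *)
Lemma local_surjection k n (F : 'rV[R]_k -> 'rV[R]_n) (A : 'M[R]_(k, n)) (P : 'M[R]_(n, k)) :
  strictly_diff F (fun d => d *m A) -> (forall z : 'rV[R]_n, z *m P *m A = z) ->
  exists2 rho : R, 0 < rho & exists2 del : R, 0 < del &
    forall z, `|z| <= del -> exists2 s, `|s| <= rho & F s = z.
Proof.
move=> [F0 _ SF] PA; have [C C0 CP] := norm_mulmx_le P.
(* Since [P] is bounded by [C], this accuracy makes [T] a contraction of factor [1/2]; with
   [|z| <= rho / (2 * C)] also [|T 0| <= rho / 2], so [T] preserves the ball of radius [rho]. *)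
have e0 : 0 < (2 * C)^-1 by rewrite invr_gt0 mulr_gt0.
have [rho rho0 H] := SF _ e0.
exists rho => //; exists (rho / (2 * C)); first by rewrite divr_gt0 // mulr_gt0.
move=> z zd.
pose T (s : 'rV[R]_k) := (z - (F s - s *m A)) *m P.
pose U : set 'rV[R]_k := [set s | `|s| <= rho].
have Tlip s s' : U s -> U s' -> `|T s - T s'| <= 2^-1 * `|s - s'|.
  move=> hs hs'; rewrite /T -mulmxBl; apply: le_trans (CP _) _.
  have -> : z - (F s - s *m A) - (z - (F s' - s' *m A)) = - (F s - F s' - (s - s') *m A).
    by rewrite mulmxBl; apply/rowP => i; rewrite !mxE; ring.
  rewrite normrN; apply: (@le_trans _ _ (C * ((2 * C)^-1 * `|s - s'|))).
    by rewrite ler_wpM2l ?(ltW C0) // H.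
  by rewrite invfM mulrA mulrCA mulfV ?mulr1 // gt_eqF.
have TU s : U s -> U (T s).
  move=> hs; have U0 : U 0 by rewrite /U /= normr0 ltW.
  have := Tlip s 0 hs U0; rewrite subr0 => h.
  rewrite /U /= -(subrK (T 0) (T s)); apply: le_trans (ler_normD _ _) _.
  have h0 : `|T 0| <= 2^-1 * rho.
    rewrite /T F0 mul0mx subr0 subr0; apply: le_trans (CP _) _.
    apply: (@le_trans _ _ (C * (rho / (2 * C)))); first by rewrite ler_wpM2l ?(ltW C0).
    by rewrite invfM mulrCA [C * _]mulrC -mulrA mulVf ?mulr1 ?gt_eqF // mulrC.
  apply: le_trans (lerD h h0) _.
  rewrite -mulrDr mulrC ler_pdivrMr // mulr_natr mulr2n lerD2r; exact: hs.
have Tfun : {homo T : x / U x >-> U x} by [].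
have ctr : is_contraction (mkfun_fun Tfun).
  exists (2^-1)%:nng; split; first by rewrite /= invf_lt1 // ltr1n.
  by move=> [s s'] [/= hs hs']; exact: Tlip.
have Ucl : closed U.
  have -> : U = closed_ball_ Num.Def.normr 0 rho.
    by apply/funext => s; apply/propext; rewrite /U /closed_ball_ /= sub0r normrN.
  exact: closed_closed_ball_.
have [||s Us sE] := banach_fixed_point ctr; first exact: Ucl.
  by exists 0; rewrite /U /= normr0 ltW.
exists s => //.
have : s *m A = z - (F s - s *m A) by rewrite {1}sE /= /T PA.
by move=> /eqP; rewrite opprB addrA eq_sym subr_eq addrC (inj_eq (addrI _)) => /eqP.
Qed.

End local_surjectivity.

(** * Reaching points by products of horizontal exponentials *)

Section chow.
Context (R : realType) (m r : nat) (G : carnotGroup R m r).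
Local Notation n := (m + r)%N.
Local Notation V := 'rV[R]_(m + r).
Local Notation "x '**' y" := (lg_mul G x y) (at level 40, left associativity).
Local Notation inv := (lg_inv G).
Local Notation step := (cg_step G).
Implicit Types (x y z u v w : V) (s t : R) (e : 'rV[R]_m).

Lemma enormZ t e : enorm (t *: e) = `|t| * enorm e.
Proof.
rewrite /enorm /dotv -sqrtr_sqr -sqrtrM ?sqr_ge0 // mulr_sumr.
by congr Num.sqrt; apply: eq_bigr => j _; rewrite !mxE; ring.
Qed.

Lemma enormN e : enorm (- e) = enorm e.
Proof. by rewrite -scaleN1r enormZ normrN1 mul1r. Qed.

Lemma enorm_ge0 e : 0 <= enorm e.
Proof. exact: sqrtr_ge0. Qed.

Definition hlen (l : seq 'rV[R]_m) : R := \sum_(e <- l) enorm e.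

Lemma hlen_cat l1 l2 : hlen (l1 ++ l2) = hlen l1 + hlen l2.
Proof. exact: big_cat. Qed.

Lemma hlen_scale t l : hlen (map ( *:%R t) l) = `|t| * hlen l.
Proof.
by rewrite /hlen big_map mulr_sumr; apply: eq_bigr => e _; rewrite enormZ.
Qed.

Lemma hlen_inv l : hlen (rev (map -%R l)) = hlen l.
Proof.
rewrite /hlen (perm_big _ (permEl (perm_rev _))) big_map.
by apply: eq_bigr => e _; rewrite enormN.
Qed.

Lemma strictly_diff_coord k (v : V) (i : 'I_k) :
  strictly_diff (fun s : 'rV[R]_k => s 0 i *: v) (fun d : 'rV[R]_k => d 0 i *: v).
Proof.
split; first by rewrite mxE scale0r.
  exists (1 + `|v|); first by rewrite ltr_pwDl.
  move=> d; rewrite normrZ mulrC; apply: ler_pM => //; last exact: coord_le_norm.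
  by rewrite lerDr.
move=> eps eps0; exists 1 => // s s' _ _.
by rewrite !mxE -!scalerBl subrr scale0r normr0 mulr_ge0 // ltW.
Qed.

Lemma strictly_diff_prod k (A : 'M[R]_(k, n)) (l : seq 'I_k) :
  strictly_diff (fun s : 'rV[R]_k => foldr (fun i z => (s 0 i *: row i A) ** z) 0 l)
    (fun d : 'rV[R]_k => \sum_(i <- l) d 0 i *: row i A).
Proof.
elim: l => [|i l IH] /=.
  split => //; first by exists 1 => // d; rewrite big_nil normr0 mul1r.
  by move=> eps eps0; exists 1 => // s s' _ _; rewrite big_nil !subr0 normr0 mulr_ge0 // ltW.
rewrite [X in strictly_diff _ X](_ : _ =
    fun d : 'rV[R]_k => d 0 i *: row i A + \sum_(j <- l) d 0 j *: row j A); last first.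
  by apply/funext => d; rewrite big_cons.
exact: strictly_diff_mul (strictly_diff_coord _ _) IH.
Qed.

(* The lines spanned by the conjugates of horizontal vectors stay in the group
   generated by [exp V_1]; a finite family of them spans the Lie algebra. *)
Lemma chow_local : exists C : R, exists2 d : R, 0 < d &
  forall z, `|z| <= d -> exists2 l, hlen l <= C & hprod G l = z.
Proof.
have [k [A [Ac As]]] := hconj_spans G.
have full := hconj_full Ac As.
have /choice[f fP] i : exists p : seq 'rV[R]_m * 'rV[R]_m,
    row i A = hprod G p.1 ** exp_V1 r p.2 ** inv (hprod G p.1).
  by have [l [e lE]] := Ac i; exists (l, e).
have S := strictly_diff_prod A (enum 'I_k).
have LE : (fun d : 'rV[R]_k => \sum_(i <- enum 'I_k) d 0 i *: row i A) = (fun d => d *m A).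
  by apply/funext => d; rewrite mulmx_sum_row big_enum.
rewrite LE in S.
have [rho rho0 [d d0 H]] := local_surjection S (fun z => mulmxKpV (full z)).
(* A conjugate of [exp (s_i E)] by [g] costs twice the length of [g] plus [|s_i|] times the norm of
   [E], and [|s_i| <= rho]. *)
pose C := \sum_(i <- enum 'I_k) (hlen (f i).1 *+ 2 + rho * enorm (f i).2).
exists C, d => // z /H[s sr <-].
exists (flatten [seq (f i).1 ++ (s 0 i *: (f i).2) :: rev (map -%R (f i).1) | i <- enum 'I_k]).
  rewrite /C; elim: (enum 'I_k) => [|i l IH] /=; first by rewrite /hlen !big_nil.
  rewrite hlen_cat big_cons lerD // hlen_cat {2}/hlen big_cons -/(hlen _) hlen_inv enormZ.
  rewrite mulr2n addrCA [leRHS]addrC lerD2r.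
  by rewrite ler_wpM2r ?enorm_ge0 // (le_trans (coord_le_norm _ _)).
elim: (enum 'I_k) => [//|i l IH] /=.
rewrite hprod_cat IH; congr (_ ** _).
by rewrite hprod_cat /= hprod_inv lg_mulA exp_V1Z conj_exp -fP.
Qed.

Lemma norm_dil_ge1 t z : 1 <= t -> `|dil G t z| <= t ^+ step * `|z|.
Proof.
move=> t1; have t0 : 0 <= t by apply: le_trans t1.
apply: norm_le_coords => [|i]; first by rewrite mulr_ge0 // exprn_ge0.
rewrite dilE normrM ger0_norm ?exprn_ge0 //; apply: ler_pM => //.
- by rewrite exprn_ge0.
- by rewrite ler_weXn2l //; have /andP[] := cg_deg_range G i.
- exact: coord_le_norm.
Qed.

Lemma norm_dil_le1 t z : 0 <= t <= 1 -> `|dil G t z| <= t * `|z|.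
Proof.
move=> /andP[t0 t1].
apply: norm_le_coords => [|i]; first by rewrite mulr_ge0.
rewrite dilE normrM ger0_norm ?exprn_ge0 //; apply: ler_pM => //.
- by rewrite exprn_ge0.
- by rewrite -[leRHS]expr1 ler_wiXn2l //; have /andP[] := cg_deg_range G i.
- exact: coord_le_norm.
Qed.

Lemma dilVK t z : t != 0 -> dil G t (dil G t^-1 z) = z.
Proof. by move=> t0; rewrite dilM mulfV // dil1. Qed.

Lemma chow_small (eps : R) : 0 < eps -> exists2 d : R, 0 < d &
  forall z, `|z| <= d -> exists2 l, hlen l <= eps & hprod G l = z.
Proof.
move=> eps0; have [C [d d0 H]] := chow_local.
(* Dilating a product by [t] brings its length from [C] down to [eps]; [1 + |C|] is used because the
   sign of [C] is unknown. The radius [t ^+ step * d] compensates the growth of the norm under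
   [dil t^-1]. *)
pose t := Num.min 1 (eps / (1 + `|C|)).
have C0 : 0 < 1 + `|C| by rewrite ltr_pwDl.
have t0 : 0 < t by rewrite lt_min ltr01 divr_gt0.
have t1 : t <= 1 by rewrite ge_min lexx.
have tV : 1 <= t^-1 by rewrite invf_ge1.
exists (t ^+ step * d); first by rewrite mulr_gt0 // exprn_gt0.
move=> z zd.
have [l lC lE] : exists2 l, hlen l <= C & hprod G l = dil G t^-1 z.
  apply: H; apply: le_trans (norm_dil_ge1 _ tV) _.
  by rewrite exprVn mulrC ler_pdivrMr ?exprn_gt0 // mulrC.
exists (map ( *:%R t) l); last by rewrite hprod_dil lE dilVK // gt_eqF.
rewrite hlen_scale gtr0_norm //.
apply: (@le_trans _ _ (eps / (1 + `|C|) * (1 + `|C|))); last by rewrite mulfVK // gt_eqF.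
apply: ler_pM; [exact: ltW|by apply: sumr_ge0 => e _; exact: enorm_ge0| |].
  by rewrite ge_min lexx orbT.
by apply: le_trans lC _; apply: le_trans (ler_norm _) _; rewrite lerDr.
Qed.

Lemma chow z : exists l, hprod G l = z.
Proof.
have [C [d d0 H]] := chow_local.
pose t := Num.min 1 (d / (1 + `|z|)).
have z0 : 0 < 1 + `|z| by rewrite ltr_pwDl.
have t0 : 0 < t by rewrite lt_min ltr01 divr_gt0.
have [l _ lE] : exists2 l, hlen l <= C & hprod G l = dil G t z.
  apply: H; apply: le_trans (norm_dil_le1 _ _) _; first by rewrite (ltW t0) ge_min lexx.
  apply: (@le_trans _ _ (d / (1 + `|z|) * (1 + `|z|))); last by rewrite mulfVK // gt_eqF.
  by apply: ler_pM => //; [exact: ltW|rewrite ge_min lexx orbT|rewrite lerDr].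
exists (map ( *:%R t^-1) l).
by rewrite hprod_dil lE dilM mulVf ?dil1 // gt_eqF.
Qed.

End chow.

(** * Absolutely continuous functions *)

Section growth.
Context (R : realType).
Local Notation mu := (@lebesgue_measure R).

(* [l] lists, from right to left, non-overlapping intervals of [[0, c]] whose
   interiors are contained in [U]. *)
Fixpoint chain (U : set R) (l : seq (R * R)) (c : R) : Prop :=
  if l is p :: l' then
    [/\ p.1 <= p.2, p.2 <= c, `]p.1, p.2[ `<=` U & chain U l' p.1]
  else 0 <= c.

Lemma chain_le U l (c d : R) : c <= d -> chain U l c -> chain U l d.
Proof.
case: l => [|p l] /= cd; first by move=> c0; apply: le_trans cd.
by move=> [? pc ? ?]; split => //; apply: le_trans cd.
Qed.

Lemma chain_nth U l (c : R) i : chain U l c -> (i < size l)%N ->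
  [/\ 0 <= (nth (0, 0) l i).1, (nth (0, 0) l i).1 <= (nth (0, 0) l i).2 &
      (nth (0, 0) l i).2 <= c].
Proof.
have ge0 l' d : chain U l' d -> 0 <= d.
  by elim: l' d => [//|p l' IH] d /= [p12 pd _ /IH p0]; rewrite (le_trans p0) // (le_trans p12).
elim: l c i => [//|p l IH] c [|i] /= [p12 pc _ H]; first by move=> _; split => //; apply: ge0 H.
rewrite ltnS => /(IH _ _ H)[h1 h2 h3]; split => //.
by rewrite (le_trans h3) // (le_trans p12).
Qed.

Lemma chain_lt U l (c : R) i j : chain U l c -> (i < j)%N -> (j < size l)%N ->
  (nth (0, 0) l j).2 <= (nth (0, 0) l i).1.
Proof.
elim: l c i j => [//|p l IH] c [|i] [//|j] /= [p12 pc _ H]; rewrite !ltnS => ij jl.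
  by have [_ _] := chain_nth H jl.
exact: IH H ij jl.
Qed.

Lemma chain_trivIset U l (c : R) : chain U l c ->
  trivIset [set: 'I_(size l)]
    (fun i => `](nth (0, 0) l i).1, (nth (0, 0) l i).2[%classic).
Proof.
move=> H; apply/trivIsetP => i j _ _ ij.
wlog lt_ij : i j ij / (i < j)%N.
  move=> W; have := ij; rewrite -val_eqE /= neq_ltn => /orP[|]; first exact: W.
  by move=> ji; rewrite setIC; apply: W => //; rewrite eq_sym.
apply/seteqP; split => // x /=; rewrite !in_itv /= => -[/andP[x1 _] /andP[_ x2]].
have := chain_lt H lt_ij (ltn_ord j).
by rewrite leNgt (lt_trans x1 x2).
Qed.

Lemma chain_measure U l (c : R) : measurable U -> chain U l c ->
  ((\sum_(p <- l) (p.2 - p.1))%:E <= mu (U `&` `[0%R, c]))%E.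
Proof.
move=> mU; elim: l c => [|p l IH] c /=; first by rewrite big_nil.
move=> [p12 pc pU H]; rewrite big_cons EFinD.
have -> : (p.2 - p.1)%:E = mu (`]p.1, p.2[%classic : set R).
  rewrite lebesgue_measure_itv /= lte_fin.
  by case: ltgtP p12 => // -> _; rewrite subrr.
have p10 : 0 <= p.1.
  by case: l H {IH} => [//|q l] H; have [q0 qq qp] := chain_nth (i := 0%N) H isT;
    rewrite (le_trans q0) // (le_trans qq).
rewrite addeC; apply: le_trans (leeD2r _ (IH _ H)) _.
rewrite -measureU //; last first.
- apply/seteqP; split => // x /=; rewrite !in_itv /= => -[[_ /andP[_ x1]] /andP[x2 _]].
  by rewrite ltNge x1 in x2.
- exact: measurableI.
apply: le_measure.
- by rewrite inE; apply: measurableU => //; exact: measurableI.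
- by rewrite inE; exact: measurableI.
- move=> x [[Ux]|] /=; rewrite !in_itv /= => /andP[x1 x2].
    by split => //; rewrite x1 (le_trans x2) // (le_trans p12).
  split; first by apply: pU; rewrite /= in_itv /= x1 x2.
  by rewrite (le_trans p10 (ltW x1)) (le_trans (ltW x2)).
Qed.

Lemma absolutely_continuous_chain (N : R -> R) (eps : R) :
  absolutely_continuous 0 1 N -> 0 < eps -> exists2 d : R, 0 < d &
    forall U l, measurable U -> (mu U < d%:E)%E -> chain U l 1 ->
      \sum_(p <- l) `|N p.2 - N p.1| <= eps.
Proof.
move=> AC /AC[d d0 H]; exists d => // U l mU Ud C.
rewrite (big_nth (0, 0)) big_mkord; apply/ltW.
apply: (H (size l) (fun i => (nth (0, 0) l i).1) (fun i => (nth (0, 0) l i).2)).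
- by move=> i; have [? ? ?] := chain_nth C (ltn_ord i).
- exact: chain_trivIset C.
- rewrite -lte_fin; apply: le_lt_trans Ud.
  rewrite -(big_mkord xpredT (fun i => (nth (0, 0) l i).2 - (nth (0, 0) l i).1)).
  rewrite -(big_nth (0, 0) xpredT (fun p => p.2 - p.1)).
  apply: le_trans (chain_measure mU C) _; apply: le_measure; rewrite ?inE //.
  exact: measurableI.
Qed.

Lemma ge0_integral_primitive (phi : R -> R) : (forall t : R, 0 <= phi t) ->
  mu.-integrable `[0, 1] (EFin \o phi) ->
  exists F : R -> R, [/\ forall x y, x <= y -> F x <= F y,
    F 1 - F 0 <= \int[mu]_(t in `[0, 1]) phi t &
    {ae mu, forall t : R, t \in `[0%R, 1%R] -> is_derive t 1 F (phi t)}].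
Proof.
move=> phi0 int; pose psi := phi \_ `[0%R, 1%R].
(* Extended by [0], [phi] has a nondecreasing primitive on the whole line, given by the integral
   over []-oo, x]]. *)
have psi0 t : 0 <= psi t by rewrite /psi patchE; case: ifP.
have ipsi : mu.-integrable [set: R] (EFin \o psi).
  by move: (int); rewrite integrable_mkcond //= restrict_EFin.
have iy (i : interval R) : mu.-integrable [set` i] (EFin \o psi).
  exact: (integrableS (E := setT)).
pose F (x : R) := \int[mu]_(t in `]-oo, x]) psi t.
exists F; split.
- move=> x y xy; rewrite -subr_ge0 /F (Rintegral_itvB (x := x)) //.
    by apply: Rintegral_ge0 => t _.
- have -> : \int[mu]_(t in `[0, 1]) phi t = F 1.
    rewrite /F /psi -Rintegral_mkcondr; congr Rintegral.
    by apply/seteqP; split => x /=; rewrite !in_itv /=; [move=> /andP[-> ->]|move=> []].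
  by rewrite lerBlDr lerDl; apply: Rintegral_ge0.
- have loc : locally_integrable [set: R] psi by exact: integrable_locally.
  have := FTC1Ny (fun y => iy `]-oo, y]) loc.
  apply: (@filterS _ _ (ae_filter_ringOfSetsType mu)) => t [d1 d2] t01; apply: DeriveDef => //.
  by rewrite -derive1E d2 /psi patchE mem_set.
Qed.

Lemma is_derive_near (V : normedModType R) (g : R -> V) (t : R) (v : V) (eps : R) :
  is_derive t 1 g v -> 0 < eps ->
  exists2 d : R, 0 < d & forall s, `|s - t| < d ->
    `|g s - g t - (s - t) *: v| <= eps * `|s - t|.
Proof.
move=> [dg gv] eps0.
have : h^-1 *: (g (h *: 1 + t) - g t) @[h --> (0 : R)^'] --> v.
  by rewrite -gv; exact: dg.
move=> /cvgrPdist_le/(_ _ eps0) /nbhs_ballP[d /= d0 H]; exists d => // s sd.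
have [->|st] := eqVneq s t; first by rewrite !subrr scale0r subr0 !normr0 mulr0.
have h0 : s - t != 0 by rewrite subr_eq0.
have : ball 0 d (s - t) by rewrite -ball_normE /= sub0r normrN.
move=> /H /(_ h0); rewrite -[(s - t) *: 1]/((s - t) * 1) mulr1 subrK => h.
rewrite -normrN opprB.
have -> : (s - t) *: v - (g s - g t) = (s - t) *: (v - (s - t)^-1 *: (g s - g t)).
  by rewrite scalerBr scalerA mulfV // scale1r.
by rewrite normrZ mulrC ler_wpM2r.
Qed.

(* A gauge argument: intervals tagged in the exceptional null set are
   controlled by absolute continuity, all the others by the pointwise bound. *)
Lemma absolutely_continuous_le_integral (N phi : R -> R) :
  absolutely_continuous 0 1 N -> (forall t : R, 0 <= phi t) ->
  mu.-integrable `[0, 1] (EFin \o phi) ->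
  {ae mu, forall t : R, t \in `[0%R, 1%R] -> forall eps : R, 0 < eps ->
    \forall s \near t, `|N s - N t| <= (phi t + eps) * `|s - t| } ->
  `|N 1 - N 0| <= \int[mu]_(t in `[0, 1]) phi t.
Proof.
move=> AC phi0 int aeN.
have [F [Fmono F01 aeF]] := ge0_integral_primitive phi0 int.
apply: le_trans _ F01; apply/ler_addgt0Pr => e0 e00.
pose eps := e0 / 3; have eps0 : 0 < eps by rewrite divr_gt0.
have [d d0 ACd] := absolutely_continuous_chain AC eps0.
have [Z [mZ Z0 ZP]] : mu.-negligible
    (~` [set t : R | t \in `[0%R, 1%R] -> is_derive t 1 F (phi t) /\
    forall eps : R, 0 < eps ->
    \forall s \near t, `|N s - N t| <= (phi t + eps) * `|s - t|]).
  have := @filterI _ _ (ae_filter_ringOfSetsType mu) _ _ aeF aeN.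
  apply: (@filterS _ _ (ae_filter_ringOfSetsType mu)) => t [h1 h2] t01.
  by split; [exact: h1|exact: h2].
have Zfin : (mu Z < +oo)%E by rewrite Z0.
have [U [oU ZU UZ]] := lebesgue_regularity_outer mZ Zfin d0.
have mU : measurable U by exact: open_measurable.
have Ud : (mu U < d%:E)%E.
  rewrite (measureDI mu mU mZ); apply: le_lt_trans UZ.
  rewrite -[leRHS]adde0 leeD2l // -Z0; apply: le_measure; rewrite ?inE //.
  exact: measurableI.
pose v (l : seq (R * R)) := \sum_(p <- l) `|N p.2 - N p.1|.
(* The invariant carried from [0] to [1]. One [eps] comes from the pointwise bound on [N], the other
   from the derivative of [F]; [v l] collects the intervals tagged in the null set, and at the end
   it costs a third [eps]. *)
pose Q (c : R) := exists2 l, chain U l c & `|N c - N 0| <= F c - F 0 + 2 * eps * c + v l.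
have gauge t : 0 <= t <= 1 -> exists2 del : R, 0 < del & forall c b,
    t - del < c -> c <= t -> t <= b -> b < t + del -> Q c -> Q b.
  move=> t01; have [tZ|tZ] := pselect (Z t).
    have /nbhs_ballP[del /= del0 H] : nbhs t U by apply: open_nbhs_nbhs; split => //; exact: ZU.
    exists del => // c b tc ct tb bt [l lc lv]; exists ((c, b) :: l) => /=.
      split => //; first exact: le_trans tb.
      move=> x /=; rewrite in_itv /= => /andP[cx xb]; apply: H.
      by rewrite -ball_normE /= ltr_norml; apply/andP; split; lra.
    rewrite /v big_cons -/(v l) /=.
    have cb : c <= b by apply: le_trans tb.
    have := Fmono _ _ cb; have := ler_distD (N c) (N b) (N 0).
    have : eps * c <= eps * b by rewrite ler_wpM2l // ltW.
    by move: lv; clear; lra.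
  have [dF HN] : is_derive t 1 F (phi t) /\ forall eps : R, 0 < eps ->
      \forall s \near t, `|N s - N t| <= (phi t + eps) * `|s - t|.
    by apply: contrapT => h; apply: tZ; apply: ZP => h'; apply: h; apply: h'; rewrite in_itv.
  have [d1 d10 HF] := is_derive_near dF eps0.
  have /nbhs_ballP[d2 /= d20 {}HN] := HN _ eps0.
  exists (Num.min d1 d2); first by rewrite lt_min d10.
  move=> c b; rewrite ltrBlDr -ltrBlDl lt_min => /andP[c1 c2] ct tb.
  rewrite -ltrBlDl lt_min => /andP[b1 b2] [l lc lv]; exists l;
    first exact: chain_le (le_trans ct tb) lc.
  have tc0 : 0 <= t - c by rewrite subr_ge0.
  have bt0 : 0 <= b - t by rewrite subr_ge0.
  have := HF c; have := HF b; have := HN c; have := HN b.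
  rewrite -!ball_normE /= !(distrC t) (distrC c t) (ger0_norm tc0) (ger0_norm bt0).
  move=> /(_ b2) Nb /(_ c2) Nc /(_ b1) Fb /(_ c1) Fc.
  move: Fb Fc; rewrite -![_ *: phi t]/(_ * phi t) => /ler_normlP[Fb _] /ler_normlP[_ Fc].
  have := ler_distD (N c) (N b) (N 0); have := ler_distD (N t) (N b) (N c).
  rewrite (distrC (N t)).
  by move: Nb Nc Fb Fc lv; clear; lra.
have Q0 : Q 0.
  by exists [::] => //=; rewrite /v big_nil !subrr normr0 mulr0 !addr0.
(* Cousin's lemma by a supremum: [gauge] at [c0 = sup S] carries [Q] from a point just below [c0] to
   [c0] and beyond, which forces [c0 = 1] and gives [Q 1]. *)
pose S := [set c : R | 0 <= c <= 1 /\ Q c].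
have S0 : S 0 by split => //; rewrite lexx ler01.
have Sub : has_ubound S by exists 1 => c [/andP[]].
have supS : has_sup S by split => //; exists 0.
pose c0 := sup S.
have c00 : 0 <= c0 by exact: (ub_le_sup Sub S0).
have c01 : c0 <= 1 by apply: ge_sup; [exists 0|move=> c [/andP[]]].
have [|del del0 H] := gauge c0; first by rewrite c00.
have [c [/andP[c0' c1'] Qc] cS] := sup_adherent del0 supS.
have cc0 : c <= c0 by apply: (ub_le_sup Sub); split => //; rewrite c0'.
have Q1 b : c0 <= b -> b < c0 + del -> Q b by move=> h1 h2; apply: H Qc.
have c0E : c0 = 1.
  apply/eqP; rewrite eq_le c01 leNgt; apply/negP => lt01.
  pose b := Num.min 1 (c0 + del / 2).
  have b0 : c0 < b by rewrite lt_min lt01 ltrDl divr_gt0.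
  suff : b <= c0 by rewrite leNgt b0.
  apply: (ub_le_sup Sub); split.
    by rewrite (le_trans c00 (ltW b0)) ge_min lexx.
  apply: Q1; first exact: ltW.
  by rewrite gt_min; apply/orP; right; rewrite ltrD2l ltr_pdivrMr // ltr_pMr // ltr1n.
have [|l lc lv] := Q1 1 c01; first by rewrite c0E ltrDl.
have := ACd U l mU Ud lc; rewrite -/(v l) => vl.
by move: lv vl; rewrite /eps; clear; lra.
Qed.

End growth.

(** * The Carnot-Caratheodory distance *)

Section carnot_caratheodory.
Context (R : realType) (m r : nat) (G : carnotGroup R m r).
Local Notation n := (m + r)%N.
Local Notation V := 'rV[R]_(m + r).
Local Notation "x '**' y" := (lg_mul G x y) (at level 40, left associativity).
Local Notation fc := (frame_comb (cg_X G)).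
Local Notation mu := (@lebesgue_measure R).
Implicit Types (x y z v w : V) (e : 'rV[R]_m).

Lemma enorm_le_sum e : enorm e <= \sum_(j < m) `|e 0 j|.
Proof.
have S0 : 0 <= \sum_(j < m) `|e 0 j| by apply: sumr_ge0.
rewrite -(ger0_norm S0) -sqrtr_sqr ler_wsqrtr // expr2 mulr_suml.
apply: ler_sum => j _; apply: le_trans (ler_norm _) _.
by rewrite normrM ler_wpM2l // (bigD1 j) //= lerDl sumr_ge0.
Qed.

Lemma coord_le_enorm e j : `|e 0 j| <= enorm e.
Proof.
rewrite -sqrtr_sqr ler_wsqrtr // /dotv (bigD1 j) //= -expr2 lerDl.
by apply: sumr_ge0 => i _; rewrite -expr2 sqr_ge0.
Qed.

Lemma integrable_enorm (u : R -> 'rV[R]_m) :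
  (forall j : 'I_m, mu.-integrable `[0, 1] (EFin \o (fun t => u t 0 j))) ->
  mu.-integrable `[0, 1] (EFin \o (fun t => enorm (u t))).
Proof.
move=> iu.
apply: (@le_integrable _ _ R mu `[0%R, 1%R]%classic _ _
  (fun t => \sum_(j < m) `|(u t 0 j)%:E|)%E) => //.
- apply/measurable_EFinP.
  have ms : measurable_fun [set: R] (@Num.sqrt R).
    by apply: continuous_measurable_fun; exact: sqrt_continuous.
  apply: (measurableT_comp ms); apply: measurable_sum => j.
  by apply: measurable_funM; apply/measurable_EFinP; exact: (measurable_int _ (iu j)).
- move=> t _ /=; rewrite sumEFin !abse_EFin lee_fin.
  rewrite (ger0_norm (enorm_ge0 _)) ger0_norm; first exact: enorm_le_sum.
  exact: sumr_ge0.
- by apply: integrable_sum => // j _; exact: integrable_abse (iu j).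
Qed.

Lemma frame_comb_exp e y :
  fc (exp_V1 r e) y = \sum_(j < m) e 0 j *: cg_X G (lshift r j) y.
Proof.
rewrite /frame_comb big_split_ord /= [X in _ + X]big1 ?addr0.
  by apply: eq_bigr => j _; rewrite row_mxEl.
by move=> j _; rewrite row_mxEr mxE scale0r.
Qed.

Lemma curve_length_ge0 (u : R -> 'rV[R]_m) : 0 <= curve_length 0 1 u.
Proof. by apply: Rintegral_ge0 => t _; exact: enorm_ge0. Qed.

Lemma cc_dist_le x y (gamma : R -> V) u : horizontal_curve G 0 1 gamma u ->
  gamma 0 = x -> gamma 1 = y -> cc_dist G x y <= curve_length 0 1 u.
Proof.
move=> H g0 g1; apply: ge_inf; last by exists gamma, u.
by exists 0 => _ [? [? [_ _ _ ->]]]; exact: curve_length_ge0.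
Qed.

Lemma cc_dist_ge0 x y : 0 <= cc_dist G x y.
Proof.
rewrite /cc_dist; set S := (X in inf X).
have [->|/set0P S0] := eqVneq S set0; first by rewrite inf0.
by apply: lb_le_inf => // _ [? [? [_ _ _ ->]]]; exact: curve_length_ge0.
Qed.

Lemma lipschitz_absolutely_continuous (W : normedModType R) (g : R -> W) (C : R) :
  (forall s t, 0 <= s -> s <= t -> t <= 1 -> `|g t - g s| <= C * (t - s)) ->
  absolutely_continuous 0 1 g.
Proof.
move=> H eps eps0; have C0 : 0 < 1 + `|C| by rewrite ltr_pwDl.
exists (eps / (1 + `|C|)); first by rewrite divr_gt0.
move=> k s t st _ lt_d.
apply: (@le_lt_trans _ _ (\sum_(i < k) (1 + `|C|) * (t i - s i))).
  apply: ler_sum => i _; have [s0 sti t1] := st i.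
  apply: le_trans (H _ _ s0 sti t1) _; rewrite ler_wpM2r ?subr_ge0 //.
  by apply: le_trans (ler_norm _) _; rewrite lerDr.
by rewrite -mulr_sumr mulrC -ltr_pdivlMr.
Qed.

Lemma C1_lipschitz k (g dg : R -> 'rV[R]_k) :
  (forall t : R, is_derive t 1 g (dg t)) -> continuous dg ->
  exists C : R, forall s t, 0 <= s -> s <= t -> t <= 1 -> `|g t - g s| <= C * (t - s).
Proof.
move=> dgt cdg.
have cn : {within `[0%R, 1%R], continuous (fun t => `|dg t|)}.
  apply: continuous_subspaceT => t; apply: (@continuous_comp _ _ _ dg); first exact: cdg.
  exact: norm_continuous.
have [c _ cP] := EVT_max ler01 cn.
exists `|dg c| => s t s0 st t1; apply: norm_le_coords => [|i].
  by rewrite mulr_ge0 // subr_ge0.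
have di a := is_derive_coord i (dgt a).
have cw : {within `[s, t], continuous (fun a => g a 0 i)}.
  apply: continuous_subspaceT => a; apply: differentiable_continuous.
  exact: is_derive_curve_differentiable (di a).
have [a] := MVT_segment st (fun a _ => di a) cw.
rewrite in_itv /= => /andP[sa at_] e.
have -> : (g t - g s) 0 i = g t 0 i - g s 0 i by rewrite !mxE.
rewrite e normrM (ger0_norm (_ : 0 <= t - s)) ?subr_ge0 // ler_wpM2r ?subr_ge0 //.
apply: le_trans (coord_le_norm _ _) (cP _ _).
by rewrite in_itv /= (le_trans s0 sa) (le_trans at_).
Qed.

Lemma cc_dist_exp x e : cc_dist G x (x ** exp_V1 r e) <= enorm e.
Proof.
pose gamma (t : R) := x ** (t *: exp_V1 r e).
have dgamma (t : R) : is_derive t 1 gamma (fc (exp_V1 r e) (gamma t))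
  by exact: is_derive_exp_curve.
have cg : continuous (fun t => fc (exp_V1 r e) (gamma t)).
  move=> t; apply: (@continuous_comp _ _ _ gamma).
    exact/differentiable_continuous/is_derive_curve_differentiable.
  exact/differentiable_continuous/differentiable_frame_comb.
have [C CP] := C1_lipschitz dgamma cg.
have H : horizontal_curve G 0 1 gamma (fun=> e).
  split; first exact: lipschitz_absolutely_continuous CP.
  - move=> j; apply/integrableP; split; first exact: measurable_cst.
    rewrite /= integral_cst //= lebesgue_measure_itv /= lte_fin ltr01 sube0 mule1.
    exact: ltry.
  - by apply: (@filterS _ _ (ae_filter_ringOfSetsType mu) setT); [move=> t _ _;
    rewrite -frame_comb_exp|exact: filterT].
have := cc_dist_le H; rewrite /gamma scale0r lg_mulg0 scale1r => /(_ _ _ erefl erefl).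
have mu01 : fine (mu (`[0%R, 1%R]%classic : set R)) = 1.
  by rewrite lebesgue_measure_itv /= lte_fin ltr01 sube0.
by rewrite /curve_length Rintegral_cst // mu01 mulr1.
Qed.

Lemma horizontal_curve_dil t (gamma : R -> V) u : 0 < t -> horizontal_curve G 0 1 gamma u ->
  horizontal_curve G 0 1 (fun s => dil G t (gamma s)) (fun s => t *: u s) /\
  curve_length 0 1 (fun s => t *: u s) = t * curve_length 0 1 u.
Proof.
move=> t0 [ac iu ae]; split; first split.
- have [C C0 CP] : exists2 C : R, 0 < C & forall x y, `|dil G t x - dil G t y| <= C * `|x - y|.
    have [C C0 CP] := norm_mulmx_le (diag_mx (\row_j t ^+ cg_deg G j) : 'M[R]_n).
    exists C => // x y; have := CP (x - y).
    suff -> : (x - y) *m diag_mx (\row_j t ^+ cg_deg G j) = dil G t x - dil G t y by [].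
    by apply/rowP => j; rewrite mul_mx_diag !mxE; ring.
  move=> eps eps0; have [|d d0 H] := ac (eps / C); first by rewrite divr_gt0.
  exists d => // k a b ab tr /(H k a b ab tr) lt_e.
  apply: (@le_lt_trans _ _ (\sum_(i < k) C * `|gamma (b i) - gamma (a i)|)).
    by apply: ler_sum => i _; exact: CP.
  by rewrite -mulr_sumr mulrC -ltr_pdivlMr.
- move=> j; have := integrableZl _ t (iu j).
  by under [X in _ -> _.-integrable _ X]eq_fun do rewrite /= mxE EFinM; apply.
- apply: (@filterS _ _ (ae_filter_ringOfSetsType mu)) ae => s H s01.
  rewrite -frame_comb_exp -(dil_exp_V1 G) -dil_frame_comb; apply: is_derive_dil.
  by rewrite frame_comb_exp; exact: H.
- rewrite /curve_length -RintegralZl //; last exact: integrable_enorm.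
  by apply: eq_Rintegral => s _; rewrite enormZ gtr0_norm.
Qed.

(** Dilate a horizontal curve from [x] to [0] of length [l] by [(1 + l)^-1]. Without such a curve
    the distance is the infimum of the empty set, which is [0], and [t = 1] will do. *)
Lemma cc_norm_dil_le1 x : exists2 t, 0 < t & cc_norm G (dil G t x) <= 1.
Proof.
rewrite /cc_norm; pose P := exists gamma u, [/\ horizontal_curve G 0 1 gamma u, gamma 0 = x
  & gamma 1 = 0].
have [[gamma [u [H g0 g1]]]|nP] := pselect P.
  have l0 := curve_length_ge0 u; set l := curve_length 0 1 u in l0.
  have t0 : 0 < (1 + l)^-1 by rewrite invr_gt0 ltr_pwDl.
  exists (1 + l)^-1 => //; have [Hd ld] := horizontal_curve_dil t0 H.
  apply: le_trans (cc_dist_le Hd _ _) _; [by rewrite g0| |].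
    by rewrite g1; apply/rowP => j; rewrite !mxE mulr0.
  by rewrite ld mulrC ler_pdivrMr ?ltr_pwDl // mul1r lerDr.
exists 1 => //; rewrite dil1 /cc_dist (_ : mkset _ = set0) ?inf0 //.
apply/seteqP; split => // l [gamma [u [H g0 g1 _]]]; apply: nP.
by exists gamma, u.
Qed.

Lemma unit_ball_compact : compact [set y : V | `|y| <= 1].
Proof.
apply: bounded_closed_compact.
  exists 1; split; first exact: num_real.
  by move=> M M1 y /= /le_trans; apply; exact: ltW.
have -> : [set y : V | `|y| <= 1] = closed_ball_ Num.Def.normr 0 1.
  by apply/funext => s; apply/propext; rewrite /closed_ball_ /= sub0r normrN.
exact: closed_closed_ball_.
Qed.

Lemma horizontal_bound : exists2 C : R, 0 < C & forall y e, `|y| <= 1 ->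
  `|fc (exp_V1 r e) y| <= C * enorm e.
Proof.
have cU := unit_ball_compact.
have /choice[B BP] (j : 'I_m) : exists B : R, forall y, `|y| <= 1 -> `|cg_X G (lshift r j)
  y| <= B.
  have cX : continuous (cg_X G (lshift r j)).
    by move=> y; rewrite -frame_comb_delta; exact/differentiable_continuous/differentiable_frame_comb.
  have := compact_bounded (continuous_compact (continuous_subspaceT cX) cU).
  move=> [M [_ HM]]; exists (M + 1) => y y1.
  by apply: (HM (M + 1)); [rewrite ltrDl|exists y].
exists (1 + \sum_(j < m) `|B j|); first by rewrite ltr_pwDl // sumr_ge0.
move=> y e y1; rewrite frame_comb_exp; apply: le_trans (ler_norm_sum _ _ _) _.
rewrite mulrDl mul1r; apply: ler_wpDl; first exact: enorm_ge0.
rewrite mulr_suml; apply: ler_sum => j _; rewrite normrZ mulrC.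
apply: ler_pM => //; last exact: coord_le_enorm.
exact: le_trans (BP j y y1) (ler_norm _).
Qed.

Lemma min1_lip (a b : R) : `|Num.min a 1 - Num.min b 1| <= `|a - b|.
Proof.
have [a1|a1] := leP a 1; have [b1|b1] := leP b 1 => //.
- by rewrite !ler0_norm; lra.
- by rewrite !ger0_norm; lra.
- by rewrite subrr normr0.
Qed.

Lemma min_norm_lip x y : `|Num.min `|x| 1 - Num.min `|y| 1| <= `|x - y|.
Proof. exact: le_trans (min1_lip _ _) (ler_dist_dist x y). Qed.

(* The function [min(|gamma|, 1)] only varies while [gamma] is in the unit
   ball, where the frame is bounded. *)
Lemma horizontal_curve_escape : exists2 c : R, 0 < c & forall (gamma : R -> V) u,
  horizontal_curve G 0 1 gamma u -> gamma 1 = 0 -> curve_length 0 1 u < c ->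
  `|gamma 0| <= 1.
Proof.
have [C C0 CP] := horizontal_bound.
exists C^-1; first by rewrite invr_gt0.
move=> gamma u H g1 lC; have [ac iu ae] := H.
pose N (t : R) := Num.min `|gamma t| 1.
pose phi (t : R) := C * enorm (u t).
have acN : absolutely_continuous 0 1 N.
  move=> eps eps0; have [d d0 Hd] := ac eps eps0; exists d => // k s t st tr /(Hd k s t st tr).
  by apply: le_lt_trans; apply: ler_sum => i _; exact: min_norm_lip.
have phi0 t : 0 <= phi t by rewrite mulr_ge0 ?enorm_ge0 // ltW.
have ie := integrable_enorm iu.
have iphi : mu.-integrable `[0, 1] (EFin \o phi).
  have := integrableZl _ C ie.
  by under [X in _ -> _.-integrable _ X]eq_fun do rewrite /= EFinM; apply.
have aeN : {ae mu, forall t : R, t \in `[0%R, 1%R] -> forall eps : R, 0 < eps ->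
    \forall s \near t, `|N s - N t| <= (phi t + eps) * `|s - t| }.
  apply: (@filterS _ _ (ae_filter_ringOfSetsType mu)) ae => t /[apply] dg eps eps0.
  have cg : {for t, continuous gamma}.
    exact/differentiable_continuous/is_derive_curve_differentiable.
  have [g1t|gt1] := leP `|gamma t| 1; last first.
    have : \forall s \near t, 1 < `|gamma s|.
      have cn : {for t, continuous (fun s => `|gamma s|)}.
        by apply: (@continuous_comp _ _ _ gamma) => //; exact: norm_continuous.
      exact: (cvgr_gt _ cn).
    apply: filterS => s gs1.
    by rewrite /N !min_r ?(ltW gs1) ?(ltW gt1) // subrr normr0 mulr_ge0 // addr_ge0 // ltW.
  have [d d0 Hd] := is_derive_near dg eps0.
  apply/nbhs_ballP; exists d => // s; rewrite -ball_normE /= distrC => /Hd h.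
  apply: le_trans (min_norm_lip _ _) _.
  rewrite -[X in `|X|](subrK ((s - t) *: \sum_(j < m) u t 0 j *: cg_X G (lshift r j) (gamma t))).
  apply: le_trans (ler_normD _ _) _; rewrite mulrDl addrC; apply: lerD => //.
  rewrite normrZ mulrC ler_wpM2r // -frame_comb_exp; exact: CP.
have := absolutely_continuous_le_integral acN phi0 iphi aeN.
rewrite RintegralZl // -/(curve_length 0 1 u) /N g1 normr0 (min_l ler01) sub0r normrN.
move=> h; rewrite leNgt; apply/negP => gt1; move: h.
rewrite min_r ?(ltW gt1) // normr1 leNgt => /negP; apply.
by rewrite mulrC -ltr_pdivlMr // div1r.
Qed.

End carnot_caratheodory.

(** * Pansu differentiability *)

Section pansu.
Context (R : realType) (m r : nat) (G : carnotGroup R m r).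
Local Notation V := 'rV[R]_(m + r).
Local Notation "x '**' y" := (lg_mul G x y) (at level 40, left associativity).
Implicit Types (x y z g h u v w : V) (e : 'rV[R]_m).

Lemma dotvDl e1 e2 e : dotv (e1 + e2) e = dotv e1 e + dotv e2 e.
Proof.
by rewrite /dotv -big_split; apply: eq_bigr => j _; rewrite mxE mulrDl.
Qed.

Lemma dotvZl (s : R) e1 e2 : dotv (s *: e1) e2 = s * dotv e1 e2.
Proof.
by rewrite /dotv mulr_sumr; apply: eq_bigr => j _; rewrite mxE mulrA.
Qed.

Lemma dotvNl e1 e2 : dotv (- e1) e2 = - dotv e1 e2.
Proof. by rewrite -scaleN1r dotvZl mulN1r. Qed.

Lemma dist_trans2 (a b c p q d1 d2 : R) :
  `|a - b - p| <= d1 -> `|b - c - q| <= d2 -> `|a - c - (q + p)| <= d1 + d2.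
Proof.
move=> h1 h2; have -> : a - c - (q + p) = (a - b - p) + (b - c - q) by ring.
exact: le_trans (ler_normD _ _) (lerD h1 h2).
Qed.

Lemma dist_trans3 (a b c p q d1 d2 d3 : R) :
  `|b - c - q| <= d1 -> `|a - b| <= d2 -> `|p - q| <= d3 ->
  `|a - c - p| <= d1 + d2 + d3.
Proof.
move=> h1 h2 h3.
have -> : a - c - p = (b - c - q) + (a - b) - (p - q) by ring.
apply: le_trans (ler_normB _ _) (lerD _ h3).
exact: le_trans (ler_normD _ _) (lerD h1 h2).
Qed.

Lemma horproj_dil t z : horproj (dil G t z) = t *: horproj z.
Proof. by apply/rowP => k; rewrite !mxE deg_horizontal expr1. Qed.

Lemma horproj_exp e : horproj (exp_V1 r e) = e.
Proof. exact: row_mxKl. Qed.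

Lemma dotv_horproj_le e : exists2 C : R, 0 < C & forall z,
  `|dotv (horproj z) e| <= C * `|z|.
Proof.
have S0 : 0 <= \sum_(j < m) `|e 0 j| by apply: sumr_ge0.
exists (1 + \sum_(j < m) `|e 0 j|); first by rewrite ltr_pwDl.
move=> z; apply: le_trans (ler_norm_sum _ _ _) _; rewrite mulrDl mul1r.
apply: ler_wpDl => //; rewrite mulr_suml; apply: ler_sum => j _.
by rewrite normrM mulrC ler_wpM2l // mxE coord_le_norm.
Qed.

Context (f : V -> R) (x : V).
Context (f_lip : cc_lipschitz G f).

Lemma lipschitz_hprod : exists2 K : R, 0 <= K & forall l y,
  `|f (y ** hprod G l) - f y| <= K * hlen l.
Proof.
have [K HK] := f_lip; exists `|K| => //; elim=> [|e l IH] y /=.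
  by rewrite lg_mulg0 subrr normr0 mulr_ge0 // /hlen big_nil.
rewrite lg_mulA; apply: le_trans (ler_distD (f (y ** exp_V1 r e)) _ _) _.
rewrite /hlen big_cons mulrDr addrC; apply: lerD (IH _).
rewrite distrC; apply: le_trans (HK _ _) _.
apply: (@le_trans _ _ (`|K| * cc_dist G y (y ** exp_V1 r e))).
  by rewrite ler_wpM2r ?cc_dist_ge0 // ler_norm.
by rewrite ler_wpM2l // cc_dist_exp.
Qed.

Context (f_der : forall j : 'I_m, dir_derivable G f x (delta_mx 0 j)).
Context (f_lin : dir_derivs_act_linearly G f x).

(** Linear action propagates the existence and the value of the derivative from the basis directions
    to their combinations. *)
Lemma dir_derivE e : dir_derivable G f x e /\
  dir_deriv G f x e = dotv e (hor_gradient G f x).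
Proof.
pose P e := dir_derivable G f x e /\ dir_deriv G f x e = dotv e (hor_gradient G f x).
have P0 : P 0.
  have E : diff_quot G f x 0 = cst 0.
    apply/funext => t; rewrite /diff_quot scaler0 /exp_V1 row_mx0 lg_mulg0.
    by rewrite subrr mul0r.
  rewrite /P /dir_derivable /dir_deriv E; split; first exact: is_cvg_cst.
  by rewrite lim_cst // /dotv big1 // => j _; rewrite mxE mul0r.
have PZ (a : R) e1 : P e1 -> P (a *: e1).
  move=> [d1 E1]; have [d E] := f_lin d1 d1 a 0; move: d E.
  by rewrite scale0r addr0 mul0r addr0 E1 => d E; split => //; rewrite dotvZl.
have PD e1 e2 : P e1 -> P e2 -> P (e1 + e2).
  move=> [d1 E1] [d2 E2]; have [d E] := f_lin d1 d2 1 1; move: d E.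
  by rewrite !scale1r !mul1r E1 E2 => d E; split => //; rewrite dotvDl.
rewrite -/(P e) (row_sum_basis e); apply: (big_ind P) => // j _; apply: PZ.
split; first exact: f_der.
rewrite /dotv (bigD1 j) //= !mxE !eqxx mul1r big1 ?addr0 // => i ij.
by rewrite mxE (negbTE ij) andbF mul0r.
Qed.

Context (x_reg : regular_point G f x).
Local Notation L := (fun h => dotv (horproj h) (hor_gradient G f x)).

(** Regularity speaks of points with [d(u) <= 1] only. Choose [a] for which [dil a u] is such a
    point and put [t = s * a]: then [dil t u = dil s (dil a u)] and [t *: e = s *: (a *: e)], so
    regularity in the direction [a *: e] applies at time [s]. *)
Lemma horizontal_increment u e (eps : R) : 0 < eps -> exists2 t0 : R, 0 < t0 &
  forall t, 0 < t -> t < t0 ->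
    `|f (x ** dil G t (u ** exp_V1 r e)) - f (x ** dil G t u)
      - t * dotv e (hor_gradient G f x)| <= eps * t.
Proof.
move=> eps0; have [a a0 ua] := cc_norm_dil_le1 G u.
have [d dE] := dir_derivE (a *: e).
have ea0 : 0 < eps * a by rewrite mulr_gt0.
have /nbhs_ballP[d0 /= d00 H] := x_reg d ea0.
exists (a * d0); first by rewrite mulr_gt0.
move=> t t0 td; pose s := t / a.
have s0 : 0 < s by rewrite divr_gt0.
have sa : s * a = t by rewrite /s mulfVK // gt_eqF.
have : ball 0 d0 s.
  by rewrite -ball_normE /= sub0r normrN gtr0_norm // ltr_pdivrMr // mulrC.
move=> /H /(_ (lt0r_neq0 s0) _ ua) /ltW.
rewrite /diff_quot dE dilM scalerA sa dotvZl dil_mul dil_exp_V1 lg_mulA => h.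
have -> : eps * t = eps * a * s by rewrite -sa; ring.
rewrite -ler_pdivrMr //; apply: le_trans _ h.
have aux (D q : R) : (D - t * q) / s = D / s - a * q.
  by have s_neq0 := lt0r_neq0 s0; rewrite -sa; field.
by rewrite -[X in _ / X](gtr0_norm s0) -normf_div aux.
Qed.

(** The base point [u] is arbitrary because the factors already treated accumulate there during the
    induction. *)
Lemma hprod_increment l u (eps : R) : 0 < eps -> exists2 t0 : R, 0 < t0 &
  forall t, 0 < t -> t < t0 ->
    `|f (x ** dil G t (u ** hprod G l)) - f (x ** dil G t u) - t * L (hprod G l)|
    <= eps * t.
Proof.
elim: l u eps => [|e l IH] u eps eps0 /=.
  exists 1 => // t t0 _; rewrite lg_mulg0 subrr sub0r normrN.
  have -> : horproj (0 : V) = 0 by apply/rowP => k; rewrite !mxE.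
  rewrite -[X in dotv X](scale0r 0) dotvZl mul0r mulr0 normr0.
  by rewrite mulr_ge0 // ltW.
have e20 : 0 < eps / 2 by rewrite divr_gt0.
have [t1 t10 H1] := horizontal_increment u e e20.
have [t2 t20 H2] := IH (u ** exp_V1 r e) _ e20.
exists (Num.min t1 t2); first by rewrite lt_min t10.
move=> t t0; rewrite lt_min => /andP[tt1 tt2].
have := H1 t t0 tt1; have := H2 t t0 tt2.
rewrite horproj_mul horproj_exp dotvDl lg_mulA mulrDr.
move=> h2 h1; apply: le_trans (dist_trans2 h2 h1) _.
by rewrite -mulrDl -splitr.
Qed.

(** Near [g0], write [g = g0 ** hprod l] with [l] short. Dilation multiplies the length of [l] by
    [t], so passing from [g0] to [g] costs a small multiple of [t], and the estimate at the single
    point [g0] serves a whole neighbourhood. *)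
Lemma uniform_increment (eps : R) : 0 < eps -> exists2 t0 : R, 0 < t0 &
  forall t, 0 < t -> t < t0 -> forall g, `|g| <= 1 ->
    `|f (x ** dil G t g) - f x - t * L g| <= eps * t.
Proof.
move=> eps0.
pose P (t : R) (g : V) := `|f (x ** dil G t g) - f x - t * L g| <= eps * t.
suff : \forall t \near (0 : R)^'+, [set g : V | `|g| <= 1] `<=` P t.
  move=> /nbhs_ballP[t0 /= t00 H]; exists t0 => // t tp tt0 g g1.
  apply: H => //.
  by rewrite -ball_normE /= sub0r normrN gtr0_norm.
apply: ((compact_near_coveringP _).1 (@unit_ball_compact R m r)) => g0 _.
have [K K0 HK] := lipschitz_hprod.
have [C C0 HC] := dotv_horproj_le (hor_gradient G f x).
(* [eps / 2] is for the estimate at [g0], and [eps / 4] for each of the changes of [f] and of the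
   linear term between [g0] and [g]. *)
have e20 : 0 < eps / 2 by rewrite divr_gt0.
have e40 : 0 < eps / 4 by rewrite divr_gt0.
have K10 : 0 < 1 + K by rewrite ltr_pwDl.
have [l0 l0E] := chow G g0.
have [t0 t00 Ht] := hprod_increment l0 0 e20.
have [d d0 Hd] : exists2 d : R, 0 < d & forall z, `|z| <= d ->
    exists2 l, hlen l <= eps / 4 / (1 + K) & hprod G l = z.
  by apply: chow_small; rewrite divr_gt0.
have near1 : \forall g \near g0, `|lg_inv G g0 ** g| <= d.
  have c1 : {for g0, continuous (lg_mul G (lg_inv G g0))}.
    apply: differentiable_continuous.
    have := @differentiable_comp _ _ _ _ (fun y : V =>
      (lg_inv G g0, y)) _ g0 _ (differentiable_mul G (lg_inv G g0, g0)).
    by apply; apply: differentiable_pair.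
  have /cvgrPdist_le/(_ _ d0)/nbhs_ballP[e e0 He] := c1.
  apply/nbhs_ballP; exists e => // g /He /=.
  by rewrite lg_mulVg sub0r normrN.
have near2 : \forall g \near g0, `|g - g0| <= eps / 4 / C.
  apply/nbhs_ballP; exists (eps / 4 / C); first by rewrite /= divr_gt0.
  by move=> g; rewrite -ball_normE /= distrC => /ltW.
have near3 : \forall t \near (0 : R)^'+, 0 < t < t0.
  apply/nbhs_ballP; exists t0 => // t; rewrite -ball_normE /= sub0r normrN => tt0 tp.
  by rewrite tp -(gtr0_norm tp).
exists ([set g | `|lg_inv G g0 ** g| <= d /\ `|g - g0| <= eps / 4 / C], [set t | 0 < t < t0]).
  split; [exact: (@filterI _ _ (nbhs_filter g0) _ _ near1 near2)|exact: near3].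
move=> [g t] /= [[/Hd[l lK lE] gg0] /andP[tp tt0]]; rewrite /P.
have gE : g = g0 ** hprod G l by rewrite lE lg_mulVKg.
have := Ht t tp tt0; rewrite lg_mul0g l0E.
have -> : dil G t (0 : V) = 0 by apply/rowP => k; rewrite !mxE mulr0.
rewrite lg_mulg0 => h1.
have h2 : `|f (x ** dil G t g) - f (x ** dil G t g0)| <= eps / 4 * t.
  rewrite gE dil_mul -hprod_dil lg_mulA; apply: le_trans (HK _ _) _.
  rewrite hlen_scale gtr0_norm // mulrCA mulrC ler_wpM2r ?(ltW tp) //.
  apply: (@le_trans _ _ ((1 + K) * (eps / 4 / (1 + K)))); last by rewrite mulrC mulfVK // gt_eqF.
  apply: ler_pM => //; first by apply: sumr_ge0 => e _; exact: enorm_ge0.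
  by rewrite lerDr.
have h3 : `|t * L g - t * L g0| <= eps / 4 * t.
  rewrite -mulrBr normrM gtr0_norm // mulrC ler_wpM2r ?(ltW tp) //.
  have -> : L g - L g0 = L (g - g0).
    by rewrite /horproj linearB /= dotvDl dotvNl.
  apply: le_trans (HC _) _; apply: (@le_trans _ _ (C * (eps / 4 / C))).
    by rewrite ler_wpM2l // ltW.
  by rewrite mulrC mulfVK // gt_eqF.
apply: le_trans (dist_trans3 h1 h2 h3) _.
by rewrite -!mulrDl ler_wpM2r ?(ltW tp) //; lra.
Qed.

Lemma group_linear_horproj : group_linear G L.
Proof.
split=> [y z|t z _]; first by rewrite horproj_mul dotvDl.
by rewrite horproj_dil dotvZl.
Qed.

(** The factor [2] leaves room for an actual curve from [h] to [0], of length less than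
    [2 * cc_norm h]. Dilated by [t^-1] it is shorter than [c], so [horizontal_curve_escape]
    applies. *)
Lemma cc_norm_dil_unit_ball : exists2 c : R, 0 < c & forall h t, 0 < t ->
  0 < cc_norm G h -> cc_norm G h * 2 <= c * t -> `|dil G t^-1 h| <= 1.
Proof.
have [c c0 Hc] := @horizontal_curve_escape R m r G.
exists c => // h t t0 h0 ht.
pose S := [set l : R | exists gamma ctl, [/\ horizontal_curve G 0 1 gamma ctl,
  gamma 0 = h, gamma 1 = 0 & l = curve_length 0 1 ctl]].
have Sinf : has_inf S.
  split; last by exists 0 => _ [? [? [_ _ _ ->]]]; exact: curve_length_ge0.
  (* A positive infimum excludes the empty set, whose infimum is [0]. *)
  apply/set0P/eqP => S0; move: h0; rewrite /cc_norm /cc_dist -/S S0 inf0.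
  by rewrite ltxx.
have [l [gamma [ctl [H g0 g1 lE]]] lS] := inf_adherent h0 Sinf.
have tV : 0 < t^-1 by rewrite invr_gt0.
have [Hd ld] := horizontal_curve_dil tV H.
have := Hc _ _ Hd; rewrite ld g0 g1; apply.
  by apply/rowP => j; rewrite !mxE mulr0.
rewrite mulrC ltr_pdivrMr // -lE; apply: lt_le_trans lS _.
by rewrite -[inf S]/(cc_norm G h) -mulr2n -mulr_natr.
Qed.

Lemma pansu_limit :
  `|f (x ** h) - f x - L h| / cc_norm G h @[h --> (0 : V)^'] --> (0 : R).
Proof.
have [c c0 Hc] := cc_norm_dil_unit_ball.
apply/cvgrPdist_le => eps eps0.
(* With [t <= 2 d(h) / c], an error of [eps * c / 2 * t] is at most [eps * d(h)]. *)
have ec0 : 0 < eps * c / 2 by rewrite !divr_gt0 // mulr_gt0.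
have [t0 t00 Ht] := uniform_increment ec0.
pose t2 := Num.min 1 (t0 / 2).
have t20 : 0 < t2 by rewrite lt_min ltr01 divr_gt0.
have t2t0 : t2 < t0 by rewrite gt_min; apply/orP; right; rewrite ltr_pdivrMr // ltr_pMr // ltr1n.
have t2V : 1 <= t2^-1 by rewrite invf_ge1 // ge_min lexx.
have t2s : 0 < t2 ^+ cg_step G by rewrite exprn_gt0.
apply/nbhs_ballP; exists (t2 ^+ cg_step G) => // h.
rewrite -ball_normE /= sub0r normrN => /ltW ht2 _.
(* Division by [0] yields [0], which settles the case [cc_norm h = 0]. *)
have [<-|h0] := eqVneq 0 (cc_norm G h); first by rewrite invr0 mulr0 subrr normr0 ltW.
have {}h0 : 0 < cc_norm G h by rewrite lt_neqAle h0 cc_dist_ge0.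
(* The cap [t2] keeps [t] below [t0] without any estimate of [d(h)] from above. When the cap is
   attained, [dil t^-1 h] lies in the unit ball because the Euclidean norm of [h] is at most
   [t2 ^+ step]. *)
pose t := Num.min (cc_norm G h * 2 / c) t2.
have t_gt0 : 0 < t by rewrite lt_min t20 divr_gt0 // mulr_gt0.
have tt0 : t < t0 by rewrite gt_min t2t0 orbT.
have g1 : `|dil G t^-1 h| <= 1.
  rewrite /t minEle; case: ifP => _.
    apply: Hc => //; first by rewrite divr_gt0 // mulr_gt0.
    by rewrite [leRHS]mulrC mulfVK // gt_eqF.
  apply: le_trans (norm_dil_ge1 _ _ t2V) _.
  by rewrite exprVn mulrC ler_pdivrMr // mul1r.
have := Ht t t_gt0 tt0 _ g1; rewrite /= dilVK ?gt_eqF // horproj_dil dotvZl.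
rewrite mulrA mulfV ?gt_eqF // mul1r => est.
rewrite sub0r normrN normf_div normr_id (gtr0_norm h0) ler_pdivrMr //.
apply: le_trans est _; apply: (@le_trans _ _ (eps * c / 2 * (cc_norm G h * 2 / c))).
  by rewrite ler_wpM2l ?(ltW ec0) // ge_min lexx.
have c_neq0 := lt0r_neq0 c0.
by rewrite le_eqVlt; apply/orP; left; apply/eqP; field.
Qed.

End pansu.

Theorem theorem4p6 (R : realType) (m r : nat) (G : carnotGroup R m r)
    (f : 'rV[R]_(m + r) -> R) (x : 'rV[R]_(m + r))
    (f_lip : cc_lipschitz G f)
    (f_der : forall j : 'I_m, dir_derivable G f x (delta_mx 0 j))
    (f_lin : dir_derivs_act_linearly G f x)
    (x_reg : regular_point G f x) :
  pansu_differentiable G f x (fun h => dotv (horproj h) (hor_gradient G f x)).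
Proof. by split; [exact: group_linear_horproj|exact: pansu_limit]. Qed.
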